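(* Under assumptions (A1)–(A4) stated in the context, as $n,p\to\infty$, $$\frac{T_{n_0}}{\sigma(T_{n_0})}\stackrel{d}{\longrightarrow}N(0,1),$$ where $$T_{n_0}=\sum_{\alpha=1}^{K}d_{\alpha\alpha}\frac{\sum_{i\neq j}X_{\alpha i}^TWX_{\alpha j}}{n_\alpha(n_\alpha-1)}+\sum_{\alpha\neq\beta}d_{\alpha\beta}\frac{\sum_{i=1}^{n_\alpha}\sum_{j=1}^{n_\beta}X_{\alpha i}^TWX_{\beta j}}{n_\alpha n_\beta}$$ and $\sigma(T_{n_0})=\sqrt{\operatorname{Var}(T_{n_0})}$.
   Context: Setting. $K\ge 2$ and $1\le q<K$ are fixed integers and $\widetilde G$ is a known real $q\times K$ matrix of rank $q$. For $\alpha=1,\dots,K$, $Y_{\alpha 1},\dots,Y_{\alpha n_\alpha}$ is an independent sample from a $p$-dimensional distribution with mean vector $\mu_\alpha$ and covariance matrix $\Sigma_\alpha$; the $K$ samples are independent of each other; $n=n_1+\cdots+n_K$. Put $X_{\alpha i}=Y_{\alpha i}-\mu_\alpha$. Let $D=\operatorname{diag}(n/n_1,\dots,n/n_K)$, $G=(\widetilde GD\widetilde G^T)^{-1/2}\widetilde G$ with columns $g_1,\dots,g_K$, and $d_{\alpha\beta}=g_\alpha^Tg_\beta$. The sums over $\alpha\ne\beta$ run over ordered pairs in $\{1,\dots,K\}$, and the sum over $i\ne j$ over ordered pairs in $\{1,\dots,n_\alpha\}$. Weight matrix. $W=B+\mathbf a\mathbf a^T$ is $p\times p$, where $\mathbf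 a=(a_1,\dots,a_p)^T$, $B=\operatorname{diag}(b_1^2,\dots,b_p^2)$, and $a_i$ and $b_i^2$ are the mean and variance of a given probability density function on $\mathbb R$, $i=1,\dots,p$. The variance of $T_{n_0}$ is $$\sigma^2(T_{n_0})=2\Big(\sum_{\alpha=1}^K\frac{d_{\alpha\alpha}^2\operatorname{tr}\big((W\Sigma_\alpha)^2\big)}{n_\alpha(n_\alpha-1)}+\sum_{\alpha\ne\beta}\frac{d_{\alpha\beta}^2\operatorname{tr}(W\Sigma_\alpha W\Sigma_\beta)}{n_\alpha n_\beta}\Big).$$ Assumptions. (A1) $Y_{\alpha i}=\Gamma_\alpha Z_{\alpha i}+\mu_\alpha$ for $i=1,\dots,n_\alpha$, $\alpha=1,\dots,K$, where $\Gamma_\alpha$ is a $p\times m$ matrix with $p\le m$ and $\Gamma_\alpha\Gamma_\alpha^T=\Sigma_\alpha$, and the $Z_{\alpha i}$ are i.i.d. $m$-dimensional random vectors with $E(Z_{\alpha i})=0$ and $\operatorname{Cov}(Z_{\alpha i})=I_m$. (A2) $E(z_{\alpha is}^4)=3+\Delta<\infty$, where $z_{\alpha is}$ is the $s$-th component of $Z_{\alpha i}$ and $\Delta$ is some constant; moreover $E(z_{\alpha is_1}^{\varsigma_1}\cdots z_{\alpha is_r}^{\varsigma_r})=E(z_{\alpha is_1}^{\varsigma_1})\cdots E(z_{\alpha is_r}^{\varsigma_r})$ for all positive integers $r$ and $\varsigma_1,\dots,\varsigma_r$ with $\sum_{s=1}^r\varsigma_s\le 8$ and all distinct indices $s_1,\dots,s_r$.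 (A3) $n_\alpha/n\to\tau_\alpha\in(0,1)$ as $n\to\infty$, for $\alpha=1,\dots,K$. (A4) As $p\to\infty$, for any $\alpha,\beta,\gamma\in\{1,\dots,K\}$, $\operatorname{tr}(W\Sigma_\alpha W\Sigma_\beta W\Sigma_\gamma W\Sigma_\beta)=o\{\operatorname{tr}(W\Sigma_\alpha W\Sigma_\beta)\operatorname{tr}(W\Sigma_\gamma W\Sigma_\beta)\}$. No relation between $p$ and $n$ is imposed; the quantities $m,\mu_\alpha,\Gamma_\alpha,\Sigma_\alpha,W$ may vary with $p$. *)

(* Defs.v *)
From mathcomp Require Export all_boot all_order all_algebra.
From mathcomp Require Export all_classical all_reals all_analysis.
Export Order.TTheory GRing.Theory Num.Theory.
Export numFieldNormedType.Exports.

Set Implicit Arguments.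
Unset Strict Implicit.
Unset Printing Implicit Defensive.

Local Open Scope classical_set_scope.
Local Open Scope ring_scope.

Section probability_notions.
Context d (T : measurableType d) (R : realType) (P : probability T R).

Definition mutually_independent d' (T' : measurableType d') (I : finType)
    (X : I -> {RV P >-> T'}) : Prop :=
  forall (J : {set I}) (A : I -> set T'), (forall i, measurable (A i)) ->
    P (\bigcap_(i in [set` J]) (X i @^-1` A i)) =
      (\prod_(i in J) P (X i @^-1` A i))%E.

Definition identically_distributed d' (T' : measurableType d') (I : Type)
    (X : I -> {RV P >-> T'}) : Prop :=
  forall (i j : I) (A : set T'), measurable A ->
    distribution P (X i) A = distribution P (X j) A.

(* Values in [\bar R] equal to a finite number force integrability, so this
   includes the existence of the first two moments. *)
Definition centered_standardized m (Z : {RV P >-> m.-tuple R}) : Prop :=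
  (forall s, 'E_P[fun w => tnth (Z w) s]%E = 0%E) /\
  (forall s t, covariance P (fun w => tnth (Z w) s) (fun w => tnth (Z w) t) =
               ((s == t)%:R)%:E).

(* E(z_{s 0}^{e 0} ... z_{s (r-1)}^{e (r-1)}) = prod_l E(z_{s l}^{e l}) for
   distinct s l and positive e l of sum at most k.  The rule is only demanded
   when the moments on its right-hand side exist; its right-hand side being
   then finite, it also says that the expectation on the left exists. *)
Definition mixed_moments_factor m (k : nat) (Z : {RV P >-> m.-tuple R}) : Prop :=
  forall (r : nat) (s : 'I_r -> 'I_m) (e : 'I_r -> nat),
    (0 < r)%N -> injective s -> (forall l, (0 < e l)%N) ->
    (\sum_(l < r) e l <= k)%N ->
    (forall l, P.-integrable setT
                 (EFin \o (fun w => tnth (Z w) (s l) ^+ e l))) ->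
    'E_P[(fun w => \prod_(l < r) tnth (Z w) (s l) ^+ e l)%R]%E =
      (\prod_(l < r) 'E_P[(fun w => tnth (Z w) (s l) ^+ e l)%R])%E.

End probability_notions.

(* Convergence in distribution, along a filter [F] of indices, of real random
   variables living on possibly different probability spaces, to a law [mu]:
   convergence of the distribution functions at every continuity point of the
   distribution function of [mu]. *)
Definition cvg_in_distribution (R : realType) (I : Type) (F : set_system I)
    (d : I -> measure_display) (T : forall i, measurableType (d i))
    (P : forall i, probability (T i) R) (X : forall i, T i -> R)
    (mu : probability (measurableTypeR R) R) : Prop :=
  forall x : R, {for x, continuous (fun y : R => mu `]-oo, y]%classic)} ->
    P i (X i @^-1` `]-oo, x]%classic) @[i --> F] --> mu `]-oo, x]%classic.

Section densities.
Context (R : realType).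
Local Notation leb := (@lebesgue_measure R).

Definition is_pdf (f : R -> R) : Prop :=
  [/\ measurable_fun setT f, forall x, 0 <= f x &
      (\int[leb]_x (f x)%:E = 1)%E].

Definition pdf_mean (f : R -> R) : \bar R := (\int[leb]_x (x * f x)%:E)%E.

Definition pdf_variance (f : R -> R) : \bar R :=
  (\int[leb]_x ((x - fine (pdf_mean f)) ^+ 2 * f x)%:E)%E.

End densities.

Section statistic.
Context (R : realType).

Definition weight_mx p (a b : 'I_p -> R) : 'M[R]_p :=
  diag_mx (\row_i b i ^+ 2) + (\col_i a i) *m (\col_i a i)^T.

Definition posdef_mx q (S : 'M[R]_q) : Prop :=
  S^T = S /\ forall v : 'cV[R]_q, v != 0 -> 0 < (v^T *m S *m v) 0 0.

(* M^(-1/2), the positive definite square root of the inverse; it is 0 when M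
   is not positive definite. *)
Definition inv_sqrt_mx q (M : 'M[R]_q) : 'M[R]_q :=
  xget 0 [set S | posdef_mx S /\ S *m S *m M = 1%:M].

Context (K q : nat) (Gt : 'M[R]_(q, K)) (ns : 'I_K -> nat).

Definition D_mx : 'M[R]_K :=
  diag_mx (\row_al ((\sum_be ns be)%N%:R / (ns al)%:R)).

Definition G_mx : 'M[R]_(q, K) := inv_sqrt_mx (Gt *m D_mx *m Gt^T) *m Gt.

Definition d_coef (al be : 'I_K) : R := ((col al G_mx)^T *m col be G_mx) 0 0.

Definition Tn0 p (W : 'M[R]_p) (X : forall al, 'I_(ns al) -> 'cV[R]_p) : R :=
  \sum_al d_coef al al *
    ((\sum_i \sum_(j | j != i) ((X al i)^T *m W *m X al j) 0 0) /
     ((ns al)%:R * ((ns al)%:R - 1))) +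
  \sum_al \sum_(be | be != al) d_coef al be *
    ((\sum_i \sum_j ((X al i)^T *m W *m X be j) 0 0) /
     ((ns al)%:R * (ns be)%:R)).

End statistic.

(* Main.v *)
From mathcomp Require Import measurable_realfun ftc normal_distribution.
From mathcomp Require Import ring lra.
Require Import Defs.

Set Implicit Arguments.
Unset Strict Implicit.
Unset Printing Implicit Defensive.

Local Open Scope classical_set_scope.
Local Open Scope ring_scope.

(** The standardized statistic is a quadratic form
    [T = 1/2 * sum_(a, b) A a b * z a * z b] in the coordinates [z a] of all the
    vectors [Z]; the kernel [A] is symmetric, vanishes on the diagonal blocks (a
    block collects the coordinates of one sample) and has squared Frobenius norm
    2.  Its asymptotic normality is proved by Stein's method, deleting one sample
    at a time.

    Write [U a = sum_b A a b * z b] ([linform]), let [Q k] be the sum of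
    [z a * U a] over the block [k] ([increment]), [S k = T - Q k] the statistic
    without sample [k] ([deleted]), and [H k] the sum of [(U a)^2] over the block
    [k] ([cond_var]).  Then [sum_k Q k = 2 * T], and given the samples other than
    [k] the increment [Q k] has mean 0 and variance [H k], whereas [S k] is fixed.
    Hence for a smooth [F],
      [E (T F(T)) = 1/2 sum_k E (Q k (F(T) - F(S k)))
                 ~  1/2 sum_k E ((Q k)^2 F'(S k))
                 =  1/2 sum_k E (H k F'(S k))  ~  1/2 E ((sum_k H k) F'(T))].
    Conditioning before the deletion is undone replaces [(Q k)^2] by [H k], so
    that only the concentration of [sum_k H k = |A z|^2] around its mean 2 is
    needed.  That is the variance of a quadratic form, at most
    [(2 + |Delta|) |A^2|^2]; the errors marked [~] are third-order terms governed
    by [E (Q k)^4] and [E (H k)^2], at most constants times the squared influence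
    of sample [k], the sum of the [A a b ^ 2] over [a] in its block.  All these
    moments come from the fourth-order mixed moments of the [z a]
    ([coord_moment4]); the outcome is [stein_bound].

    The assumptions enter through the two small quantities.  Samples of one
    population have the same influence, so it is at most [2 / n_alpha]
    ([typed_kernel_infl]), which vanishes by the convergence of the proportions.
    The traces in the last assumption are squared Frobenius norms of
    [G alpha beta = Gamma_alpha^T W Gamma_beta] and of products of two such
    matrices ([frob_bilinear], [frob_bilinear_mul]), and the triangle and
    Cauchy-Schwarz inequalities turn the assumption into [|A^2|^2 <= 4 eps]
    ([typed_kernel_sqr]).

    It remains to pass from [E (F'(T) - T F(T))] to distribution functions.  For
    a Lipschitz [h], the equation [f' - x f = h - E h(N)] has a solution bounded
    by Mills' estimate; multiplied by a slowly varying cutoff it becomes an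
    admissible [F] and still solves the equation up to an error that is small in
    mean under a unit variance ([stein_approx]).  Piecewise affine [h] then
    sandwich the indicator of a half-line ([quad_stat_cdf]). *)

(** * Real-valued expectations *)

Section real_expectation.
Context d (T : measurableType d) (R : realType) (P : probability T R).
Implicit Types X Y : T -> R.

Definition rint X := P.-integrable setT (EFin \o X).
Definition rexp X : R := \int[P]_w X w.

Lemma rint_meas X : rint X -> measurable_fun setT X.
Proof. by move=> /measurable_int/measurable_EFinP. Qed.

Lemma rexpE X : rint X -> 'E_P[X]%E = (rexp X)%:E.
Proof.
by move=> iX; rewrite unlock /rexp /Rintegral fineK//; exact: integrable_fin_num.
Qed.

Lemma rint_cst c : rint (fun=> c).
Proof. exact: finite_measure_integrable_cst. Qed.

Lemma rintD X Y : rint X -> rint Y -> rint (fun w => X w + Y w).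
Proof. by move=> iX iY; exact: integrableD iX iY. Qed.

Lemma rintZ c X : rint X -> rint (fun w => c * X w).
Proof. by move=> iX; exact: (integrableZl _ c iX). Qed.

Lemma rintB X Y : rint X -> rint Y -> rint (fun w => X w - Y w).
Proof. by move=> iX iY; exact: integrableB iX iY. Qed.

Lemma rint_sum I (s : seq I) (Q : pred I) (X : I -> T -> R) :
  (forall i, Q i -> rint (X i)) -> rint (fun w => \sum_(i <- s | Q i) X i w).
Proof.
move=> iX; have := @integrable_sum _ T R P setT measurableT I s Q
  (fun i w => (X i w)%:E) iX.
by apply: eq_integrable => // w _ /=; rewrite sumEFin.
Qed.

Lemma rint_norm X : rint X -> rint (fun w => `|X w|).
Proof. exact: integrable_norm. Qed.

Lemma rint_le X Y : measurable_fun setT X -> (forall w, `|X w| <= Y w) ->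
  rint Y -> rint X.
Proof.
move=> mX XY iY; apply: le_integrable iY => //; first exact/measurable_EFinP.
by move=> w _ /=; rewrite lee_fin (le_trans (XY w))// ler_norm.
Qed.

Lemma rint_bounded X (c : R) : measurable_fun setT X ->
  (forall w, `|X w| <= c) -> rint X.
Proof. by move=> mX Xc; apply: (rint_le mX Xc); exact: rint_cst. Qed.

Lemma rexp_cst c : rexp (fun=> c) = c.
Proof.
rewrite /rexp Rintegral_cst//.
by rewrite [X in fine X](@probability_setT _ _ _ P) mulr1.
Qed.

Lemma rexpD X Y : rint X -> rint Y ->
  rexp (fun w => X w + Y w) = rexp X + rexp Y.
Proof. by move=> iX iY; exact: RintegralD. Qed.

Lemma rexpB X Y : rint X -> rint Y ->
  rexp (fun w => X w - Y w) = rexp X - rexp Y.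
Proof. by move=> iX iY; exact: RintegralB. Qed.

Lemma rexpZ c X : rint X -> rexp (fun w => c * X w) = c * rexp X.
Proof. by move=> iX; exact: RintegralZl. Qed.

Lemma rexp_sum I (s : seq I) (Q : pred I) (X : I -> T -> R) :
  (forall i, Q i -> rint (X i)) ->
  rexp (fun w => \sum_(i <- s | Q i) X i w) = \sum_(i <- s | Q i) rexp (X i).
Proof.
move=> iX; elim: s => [|i s IHs].
  under [X in rexp X]eq_fun do rewrite big_nil.
  by rewrite rexp_cst big_nil.
under [X in rexp X]eq_fun do rewrite big_cons.
rewrite big_cons; case: ifP => Qi //.
by rewrite rexpD ?IHs//; [exact: iX|exact: rint_sum].
Qed.

Lemma rexp_le X Y : rint X -> rint Y -> (forall w, X w <= Y w) ->
  rexp X <= rexp Y.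
Proof. by move=> iX iY XY; apply: le_Rintegral. Qed.

Lemma rexp_norm_le X Y : measurable_fun setT X -> rint Y ->
  (forall w, `|X w| <= Y w) -> `|rexp X| <= rexp Y.
Proof.
move=> mX iY XY; have iX := rint_le mX XY iY.
apply: (le_trans (le_normr_Rintegral _ _)) => //.
by apply: rexp_le => //; exact: rint_norm.
Qed.

End real_expectation.

(** * Independence *)

Section independence.
Context d (T : measurableType d) (R : realType) (P : probability T R).

Definition indep_sigma (G H : set (set T)) :=
  forall A B, <<s G>> A -> <<s H>> B -> P (A `&` B) = (P A * P B)%E.

Definition sub_measurable (G : set (set T)) (X : T -> R) :=
  measurable_fun [set: g_sigma_algebraType G] (X : g_sigma_algebraType G -> R).

Lemma sub_sigma_measurable (G : set (set T)) :
  G `<=` measurable -> <<s G>> `<=` measurable.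
Proof. by move=> GM; apply: smallest_sub => //; exact: sigma_algebra_measurable. Qed.

Lemma sub_measurable_meas G X : G `<=` measurable ->
  sub_measurable G X -> measurable_fun setT X.
Proof.
move=> /sub_sigma_measurable GM mX _ B mB.
by apply: GM; have := mX measurableT B mB.
Qed.

(** A Dynkin argument extends independence of a fixed event from a pi-system to
    the sigma-algebra that it generates. *)
Lemma indep_sigma_half (G : set (set T)) (B : set T) :
  G `<=` measurable -> setI_closed G -> measurable B ->
  (forall A, G A -> P (A `&` B) = (P A * P B)%E) ->
  forall A, <<s G>> A -> P (A `&` B) = (P A * P B)%E.
Proof.
move=> GM GI mB GB.
have sGM := sub_sigma_measurable GM.
have fP A : measurable A -> P A \is a fin_num by exact: fin_num_measure.
apply: (@dynkin_induction _ (g_sigma_algebraType G) G) => //.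
- by rewrite setTI [X in (X * _)%E](@probability_setT _ _ _ P) mul1e.
- move=> S mS PS; have {}mS : d.-measurable S by exact: sGM.
  have PSB : P (~` S `&` B) = (P B - P (S `&` B))%E.
    rewrite setIC -setDE measureD//; last by rewrite ltey_eq fin_num_measure.
    by rewrite setIC.
  rewrite PSB (PS : P (S `&` B) = _) (probability_setC _ mS).
  by rewrite muleBl ?mul1e ?fin_num_adde_defr ?fP//.
- move=> F mF tF PF; have {}mF n : d.-measurable (F n) := sGM _ (mF n).
  rewrite setI_bigcupl measure_bigcup//=; last 2 first.
  + by move=> n _; exact: measurableI.
  + move=> i j _ _ [x [[Fix _] [Fjx _]]]; apply: tF => //.
    by exists x.
  rewrite measure_bigcup//= muleC -(fineK (fP _ mB)) -nneseriesZl//.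
  by apply: eq_eseriesr => n _; rewrite fineK ?fP// muleC; exact: PF.
Qed.

Lemma indep_sigma_gen (G H : set (set T)) :
  G `<=` measurable -> H `<=` measurable -> setI_closed G -> setI_closed H ->
  (forall A B, G A -> H B -> P (A `&` B) = (P A * P B)%E) -> indep_sigma G H.
Proof.
move=> GM HM GI HI GH A B sA sB.
apply: (indep_sigma_half GM GI) => //; first exact: (sub_sigma_measurable HM).
move=> {A sA} A GA; rewrite setIC muleC; apply: (indep_sigma_half HM HI) => //.
  exact: GM.
by move=> {B sB} B HB; rewrite setIC muleC GH.
Qed.

(** Independence identifies the joint law of the pair with a product measure,
    so that the expectation of the product is an iterated integral. *)
Lemma rexp_indep (G H : set (set T)) (X Y : T -> R) :
  G `<=` measurable -> H `<=` measurable -> indep_sigma G H ->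
  sub_measurable G X -> sub_measurable H Y -> rint P X -> rint P Y ->
  rint P (fun w => X w * Y w) /\
  rexp P (fun w => X w * Y w) = rexp P X * rexp P Y.
Proof.
move=> GM HM GH sX sY iX iY.
have mX := rint_meas iX; have mY := rint_meas iY.
pose Xm : {RV P >-> R} :=
  MeasurableFun.Pack (MeasurableFun.Class (isMeasurableFun.Build _ _ _ _ _ mX)).
pose Ym : {RV P >-> R} :=
  MeasurableFun.Pack (MeasurableFun.Class (isMeasurableFun.Build _ _ _ _ _ mY)).
have mXY : measurable_fun setT (fun w => (X w, Y w) : R * R).
  exact: measurable_fun_pair.
pose XY : {RV P >-> (R * R)%type} :=
  MeasurableFun.Pack (MeasurableFun.Class (isMeasurableFun.Build _ _ _ _ _ mXY)).
pose m1 : probability _ R := distribution P Xm.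
pose m2 : probability _ R := distribution P Ym.
pose m12 : probability _ R := distribution P XY.
have lawE A : measurable A -> (m1 \x m2)%E A = m12 A.
  apply: product_measure_unique => B C mB mC.
  have sA : <<s G>> (X @^-1` B).
    by rewrite -[X in <<s G>> X]setTI; exact: sX.
  have sB : <<s H>> (Y @^-1` C).
    by rewrite -[X in <<s H>> X]setTI; exact: sY.
  exact: GH.
pose f (z : R * R) := (z.1 * z.2)%:E.
have mf : measurable_fun setT f.
  apply/measurable_EFinP; apply: measurable_funM => //.
have mE : measurable_fun setT (EFin : R -> \bar R) by exact/measurable_EFinP.
have iX1 : m1.-integrable setT (EFin : R -> \bar R).
  exact: (integrable_pushforward mX mE).
have iY2 : m2.-integrable setT (EFin : R -> \bar R).
  exact: (integrable_pushforward mY mE).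
have fX : (\int[m1]_x (x%:E) = (rexp P X)%:E)%E.
  rewrite (integral_pushforward mX mE)// /rexp /Rintegral fineK//.
  exact: integrable_fin_num.
have fY : (\int[m2]_x (x%:E) = (rexp P Y)%:E)%E.
  rewrite (integral_pushforward mY mE)// /rexp /Rintegral fineK//.
  exact: integrable_fin_num.
have if_ : (m1 \x m2)%E.-integrable setT f.
  apply/integrable12ltyP => //.
  rewrite (eq_integral (fun x : R => `|x%:E| * \int[m2]_y `|y%:E|)%E); last first.
    move=> x _; rewrite -ge0_integralZl//.
      by apply: eq_integral => y _; rewrite /f EFinM abseM.
    exact: measurableT_comp.
  rewrite ge0_integralZr//; last 2 first.
  - exact: measurableT_comp.
  - by apply: integral_ge0.
  apply: lte_mul_pinfty; [exact: integral_ge0| |].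
    rewrite ge0_fin_numE; last exact: integral_ge0.
    by case/integrableP: iX1.
  by case/integrableP: iY2.
have iXY : P.-integrable setT (f \o (fun w => (X w, Y w))).
  apply/integrableP; split; first exact: measurableT_comp.
  have /integrableP[_] := if_.
  rewrite (eq_measure_integral m12); last first.
    by move=> A mA _; exact: lawE.
  by rewrite ge0_integral_pushforward//; exact: measurableT_comp.
split; first exact: iXY.
apply: EFin_inj; rewrite EFinM -fX -fY.
transitivity (\int[P]_w (f \o (fun w => (X w, Y w))) w)%E.
  by rewrite /rexp /Rintegral fineK//; exact: integrable_fin_num.
transitivity (\int[m12]_z f z)%E.
  by rewrite integral_pushforward.
rewrite -(eq_measure_integral m12 (m1 := (m1 \x m2)%E)); last first.
  by move=> A mA _; exact: lawE.
rewrite -integral12_prod_meas1//.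
rewrite (eq_integral (fun x : R => x%:E * \int[m2]_y y%:E)%E); last first.
  move=> x _; rewrite -integralZl//.
rewrite fY integralZr//.
Qed.

End independence.

Section cylinders.
Context d (T : measurableType d) (R : realType) (P : probability T R).
Context d' (T' : measurableType d') (I : finType) (Z : I -> {RV P >-> T'}).

(** A pi-system generating the sigma-algebra of the variables indexed by [S]. *)
Definition cylinders (S : {set I}) : set (set T) :=
  [set A | exists2 B : I -> set T', (forall i, measurable (B i)) &
     A = \bigcap_(i in [set` S]) Z i @^-1` B i].

Lemma cylinders_measurable S : cylinders S `<=` measurable.
Proof.
move=> _ [B mB ->]; apply: fin_bigcap_measurable; first exact: finite_finset.
by move=> i _; rewrite -[X in measurable X]setTI; exact: measurable_funP.
Qed.

Lemma cylinders_setI S : setI_closed (cylinders S).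
Proof.
move=> _ _ [B mB ->] [C mC ->]; exists (fun i => B i `&` C i).
  by move=> i; exact: measurableI.
by rewrite -bigcapI; apply: eq_bigcapr => i _; rewrite preimage_setI.
Qed.

Lemma cylinders_comp (S : {set I}) k (g : T' -> R) : k \in S ->
  measurable_fun setT g -> sub_measurable (cylinders S) (g \o Z k).
Proof.
move=> kS mg _ B mB; rewrite setTI; apply: sub_sigma_algebra.
exists (fun i => if i == k then g @^-1` B else setT) => [i|].
  by case: ifP => // _; rewrite -[X in measurable X]setTI; exact: mg.
apply/seteqP; split => [w gw i _|w /(_ k kS)] /=.
  by case: eqP => [->|].
by rewrite eqxx.
Qed.

(** The product rule over all subfamilies makes disjoint groups of variables
    independent: on the cylinders, both sides are the product over the union. *)
Lemma cylinders_indep (S S' : {set I}) : mutually_independent Z ->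
  [disjoint S & S']%bool -> indep_sigma P (cylinders S) (cylinders S').
Proof.
move=> indZ SS'; apply: indep_sigma_gen; try exact: cylinders_measurable;
  try exact: cylinders_setI.
move=> _ _ [B mB ->] [C mC ->].
pose D i := if i \in S then B i else C i.
have mD i : measurable (D i) by rewrite /D; case: ifP.
have SD : \bigcap_(i in [set` S]) Z i @^-1` B i =
          \bigcap_(i in [set` S]) Z i @^-1` D i.
  by apply: eq_bigcapr => i /= iS; rewrite /D iS.
have S'D : \bigcap_(i in [set` S']) Z i @^-1` C i =
           \bigcap_(i in [set` S']) Z i @^-1` D i.
  by apply: eq_bigcapr => i /= iS; rewrite /D (disjointFl SS' iS).
rewrite SD S'D -bigcap_setU.
have -> : [set` S] `|` [set` S'] = [set` (S :|: S')%SET].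
  by apply/seteqP; split => i /=; rewrite inE => /orP.
rewrite !indZ// -bigU//=.
by apply: eq_bigl => i; rewrite inE.
Qed.

End cylinders.

(** * Moments of the coordinates *)

(** Every monomial is dominated by the largest coordinate, truncated below at 1;
    this is what makes monomials integrable under a moment condition. *)
Lemma prodr_exp_le (R : realDomainType) (J : finType) (x : J -> R)
    (c : J -> nat) k : (\sum_a c a <= k)%N ->
  `|\prod_a x a ^+ c a| <= 1 + \sum_a `|x a| ^+ k.
Proof.
move=> ck; pose B := \big[Num.max/1]_a `|x a|.
have B1 : 1 <= B by exact: bigmax_ge_id.
have xB a : `|x a| <= B by exact: le_bigmax.
have BE : B ^+ k <= 1 + \sum_a `|x a| ^+ k.
  have : B = 1 \/ exists a, B = `|x a|.
    rewrite /B; elim/big_rec: _ => [|a y _ IH]; first by left.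
    rewrite /Num.max; case: ifP => _ //; right; by exists a.
  case=> [->|[a ->]]; first by rewrite expr1n lerDl sumr_ge0.
  rewrite (bigD1 a)//= addrCA lerDl addr_ge0// sumr_ge0//.
apply: le_trans BE; apply: le_trans (_ : B ^+ (\sum_a c a)%N <= _).
  rewrite normr_prod -prodrXr; apply: ler_prod => a _.
  by rewrite normr_ge0/= normrX lerXn2r ?nnegrE// (le_trans _ B1).
by rewrite ler_weXn2l.
Qed.

Section product_rule.
Context d (T : measurableType d) (R : realType) (P : probability T R).
Context d' (T' : measurableType d') (I : finType) (Z : I -> {RV P >-> T'}).
Hypothesis indZ : mutually_independent Z.

Lemma rexp_prod_indep (g : I -> T' -> R) (r : seq I) : uniq r ->
  (forall k, measurable_fun setT (g k)) ->
  (forall k, rint P (g k \o Z k)) ->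
  rint P (fun w => \prod_(k <- r) g k (Z k w)) /\
  rexp P (fun w => \prod_(k <- r) g k (Z k w)) =
    \prod_(k <- r) rexp P (g k \o Z k).
Proof.
move=> + mg ig; elim: r => [_|k r IHr /= /andP[kr ur]].
  under eq_fun do rewrite big_nil.
  by rewrite big_nil rexp_cst; split => //; exact: rint_cst.
have [ir rE] := IHr ur.
under eq_fun do rewrite big_cons.
rewrite big_cons -rE.
apply: (rexp_indep (@cylinders_measurable _ _ _ _ _ _ _ Z [set k])
  (@cylinders_measurable _ _ _ _ _ _ _ Z [set x in r])) => //.
- apply: cylinders_indep => //; rewrite disjoint_subset.
  by apply/fintype.subsetP => x; rewrite !inE => /eqP ->.
- by apply: cylinders_comp; rewrite ?inE.
- suff sub s : {subset s <= r} -> sub_measurable (cylinders Z [set x in r])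
      (fun w => \prod_(j <- s) g j (Z j w)) by exact: sub.
  rewrite /sub_measurable; elim: s => [_|x s IHs sr].
    by under [X in measurable_fun _ X]eq_fun do rewrite big_nil; exact: measurable_cst.
  under [X in measurable_fun _ X]eq_fun do rewrite big_cons.
  apply: measurable_funM.
    by apply: cylinders_comp => //; rewrite inE sr ?mem_head.
  by apply: IHs => y ys; rewrite sr// inE ys orbT.
- exact: ig.
Qed.

End product_rule.

Section moments.
Context d (T : measurableType d) (R : realType) (P : probability T R).
Context (I : finType) (m : nat) (Z : I -> {RV P >-> m.-tuple R}).
Context (Delta : R).
Hypothesis indZ : mutually_independent Z.
Hypothesis stdZ : forall k, centered_standardized (Z k).
Hypothesis fourthZ : forall k s,
  'E_P[(fun w => tnth (Z k w) s ^+ 4)%R]%E = (3 + Delta)%:E.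
Hypothesis factorZ : forall k, mixed_moments_factor 8 (Z k).

Local Notation J := (I * 'I_m)%type.
Definition coord (a : J) (w : T) : R := tnth (Z a.1 w) a.2.

Lemma coord_meas a : measurable_fun setT (coord a).
Proof.
apply: (measurableT_comp (measurable_tnth a.2)); exact: measurable_funP.
Qed.

Lemma coord_sub (S : {set I}) a : a.1 \in S ->
  sub_measurable (cylinders Z S) (coord a).
Proof.
by move=> aS; apply: (cylinders_comp (g := (fun x => tnth x a.2))) => //;
  exact: measurable_tnth.
Qed.

Lemma coord_int4 a : rint P (fun w => coord a w ^+ 4).
Proof.
apply/integrableP; split.
  by apply/measurable_EFinP/measurable_funX; exact: coord_meas.
rewrite (eq_integral (fun w => (coord a w ^+ 4)%:E)); last first.
  by move=> w _ /=; rewrite ger0_norm// exprn_even_ge0.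
by have := fourthZ a.1 a.2; rewrite unlock => ->; rewrite ltry.
Qed.

Lemma monom_int (c : J -> nat) : (\sum_a c a <= 4)%N ->
  rint P (fun w => \prod_a coord a w ^+ c a).
Proof.
move=> c4; apply: (rint_le (Y := fun w => 1 + \sum_a coord a w ^+ 4)).
- by apply: measurable_prod => a _; apply: measurable_funX; exact: coord_meas.
- move=> w; apply: le_trans (prodr_exp_le _ c4) _.
  by rewrite lerD2l; apply: ler_sum => a _; rewrite -normrX ger0_norm//
    exprn_even_ge0.
- apply: rintD; first exact: rint_cst.
  by apply: rint_sum => a _; exact: coord_int4.
Qed.

Lemma coordX_int a j : (j <= 4)%N -> rint P (fun w => coord a w ^+ j).
Proof.
move=> j4; have := @monom_int (fun b => if b == a then j else 0%N).
rewrite (bigD1 a)//= eqxx big1 ?addn0 => [|b /negPf -> //].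
move=> /(_ j4); congr rint; apply/funext => w.
rewrite (bigD1 a)//= eqxx big1 ?mulr1// => b /negPf -> //.
Qed.

Lemma coord_exp1 a : rexp P (coord a) = 0.
Proof.
have [+ _] := stdZ a.1; move=> /(_ a.2).
by rewrite -[X in expectation _ X]/(coord a) rexpE => [[]//|]; apply: coordX_int 1 _.
Qed.

Lemma coord_exp2 a : rexp P (fun w => coord a w ^+ 2) = 1.
Proof.
have [h0 h1] := stdZ a.1.
have := h1 a.2 a.2; rewrite eqxx unlock h0/=.
set X := (X in expectation _ X); rewrite (_ : X = fun w => coord a w ^+ 2).
  by rewrite rexpE => [[]//|]; exact: coordX_int.
by apply/funext => w; rewrite expr2 /coord -[X in _ = X * _]subr0
  -[X in _ = _ * X]subr0.
Qed.

Lemma coord_exp4 a : rexp P (fun w => coord a w ^+ 4) = 3 + Delta.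
Proof.
have := fourthZ a.1 a.2; rewrite rexpE => [[]//|]; exact: coord_int4.
Qed.

Lemma block_int k (c : 'I_m -> nat) : (\sum_s c s <= 4)%N ->
  rint P (fun w => \prod_s coord (k, s) w ^+ c s).
Proof.
move=> c4; have := @monom_int (fun a => if a.1 == k then c a.2 else 0%N).
rewrite -(pair_bigA _ (fun i s => if i == k then c s else 0%N))/=.
rewrite (bigD1 k)//= eqxx [X in (_ + X)%N]big1 => [|i /negPf ->]; last first.
  by rewrite big1.
rewrite addn0 => /(_ c4); congr rint; apply/funext => w.
rewrite -(pair_bigA _ (fun i s => coord (i, s) w ^+
  (if i == k then c s else 0%N)))/=.
rewrite (bigD1 k)//= eqxx [X in _ * X]big1 ?mulr1// => i /negPf ->.
by rewrite big1.
Qed.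

(** The factorization hypothesis concerns positive exponents only, and is applied
    to the support of [c]. *)
Lemma block_moment k (c : 'I_m -> nat) : (\sum_s c s <= 4)%N ->
  rexp P (fun w => \prod_s coord (k, s) w ^+ c s) =
  \prod_s rexp P (fun w => coord (k, s) w ^+ c s).
Proof.
move=> c4; pose S := [set s | (0 < c s)%N]%SET.
have suppE (F : 'I_m -> R) : (forall s, c s = 0%N -> F s = 1) ->
    \prod_s F s = \prod_(l < #|S|) F (enum_val l).
  move=> F1; rewrite -(big_enum_val (fun s => F s)) [LHS](bigID (mem S))/=.
  rewrite [X in _ * X]big1 ?mulr1// => s; rewrite inE -eqn0Ngt => /eqP.
  exact: F1.
rewrite suppE => [|s ->]; last first.
  by under [X in rexp _ X]eq_fun do rewrite expr0; rewrite rexp_cst.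
under [X in rexp _ X]eq_fun => w.
  rewrite suppE => [|s ->]; last by rewrite expr0.
  over.
have [S0|S0] := posnP #|S|.
  have no (l : 'I_#|S|) : False by have := ltn_ord l; rewrite [X in (_ < X)%N]S0.
  rewrite big1 => [|l _]; last by case: (no l).
  under [X in rexp _ X]eq_fun => w.
    rewrite big1 => [|l _]; last by case: (no l).
    over.
  by rewrite rexp_cst.
have cle s : (c s <= 4)%N by apply: leq_trans c4; rewrite (bigD1 s)//= leq_addr.
have := @block_int k c c4.
under [X in rint _ X]eq_fun => w.
  rewrite suppE => [|s ->]; last by rewrite expr0.
  over.
move=> ic; apply: EFin_inj; rewrite -rexpE//.
rewrite (@factorZ k #|S| enum_val (fun l => c (enum_val l)) S0 enum_val_inj).
- rewrite -prodEFin; apply: eq_bigr => l _; rewrite -rexpE//.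
  exact: coordX_int.
- by move=> l; have := enum_valP l; rewrite inE.
- rewrite -(big_enum_val (fun s => c s))/=; apply: leq_trans (leq_trans c4 _) => //.
  by rewrite [leqRHS](bigID (mem S))/= leq_addr.
- by move=> l; exact: (@coordX_int (k, enum_val l)).
Qed.

Lemma coord_moment (c : J -> nat) : (\sum_a c a <= 4)%N ->
  rexp P (fun w => \prod_a coord a w ^+ c a) =
  \prod_a rexp P (fun w => coord a w ^+ c a).
Proof.
move=> c4.
have cs i : (\sum_s c (i, s) <= 4)%N.
  have cE : (\sum_a c a = \sum_i \sum_s c (i, s))%N.
    by rewrite (pair_bigA _ (fun i s => c (i, s))); apply: eq_bigr => -[].
  by apply: leq_trans c4; rewrite cE (bigD1 i)//= leq_addr.
pose g i (x : m.-tuple R) := \prod_s tnth x s ^+ c (i, s).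
have mg i : measurable_fun setT (g i).
  apply: measurable_prod => s _; apply: measurable_funX; exact: measurable_tnth.
have ig i : rint P (g i \o Z i) by exact: block_int.
have [_ gE] := rexp_prod_indep indZ (index_enum_uniq I) mg ig.
transitivity (rexp P (fun w => \prod_k g k (Z k w))).
  congr rexp; apply/funext => w.
  by rewrite (pair_bigA _ (fun i s => tnth (Z i w) s ^+ c (i, s)))/=;
    apply: eq_bigr => -[].
rewrite gE (eq_bigr (fun i => \prod_s rexp P (fun w => coord (i, s) w ^+ c (i, s)))).
  rewrite (pair_bigA _ (fun i s => rexp P (fun w => coord (i, s) w ^+ c (i, s)))).
  by apply: eq_bigr => -[].
move=> i _; exact: block_moment.
Qed.

Definition krond (a b : J) : R := (a == b)%:R.

Lemma prod_exp1 a w : \prod_x coord x w ^+ (x == a) = coord a w.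
Proof.
by rewrite (bigD1 a)//= eqxx big1 ?mulr1// => x /negPf ->.
Qed.

Lemma sum_pred1 (a : J) : (\sum_x (x == a) = 1)%N.
Proof. by rewrite (bigD1 a)//= eqxx big1// => x /negPf ->. Qed.

Lemma coord_int_mul4 a b c e :
  rint P (fun w => coord a w * coord b w * coord c w * coord e w).
Proof.
have := @monom_int (fun x => (x == a) + (x == b) + (x == c) + (x == e))%N.
rewrite !big_split/= !sum_pred1 => /(_ isT); congr rint; apply/funext => w.
by under eq_bigr do rewrite !exprD; rewrite !big_split/= !prod_exp1.
Qed.

Lemma coord_int_mul2 a b : rint P (fun w => coord a w * coord b w).
Proof.
have := @monom_int (fun x => (x == a) + (x == b))%N.
rewrite !big_split/= !sum_pred1 => /(_ isT); congr rint; apply/funext => w.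
by under eq_bigr do rewrite !exprD; rewrite !big_split/= !prod_exp1.
Qed.

Lemma coord_moment2 a b :
  rexp P (fun w => coord a w * coord b w) = krond a b.
Proof.
rewrite /krond; have [->|ab] := eqVneq a b; first exact: coord_exp2.
have := @coord_moment (fun x => (x == a) + (x == b))%N.
rewrite !big_split/= !sum_pred1 => /(_ isT).
under [X in rexp _ X]eq_fun => w.
  under eq_bigr do rewrite !exprD.
  rewrite !big_split/= !prod_exp1; over.
by move=> ->; rewrite (bigD1 a)//= eqxx (negPf ab) coord_exp1 mul0r.
Qed.

(** The case of [coord_moment4] to which the others reduce: unless the first index
    is repeated the moment vanishes, and if it is, a permutation of the factors
    leads to this case. *)
Lemma coord_moment4_pair a c e :
  rexp P (fun w => coord a w * coord a w * coord c w * coord e w) =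
  krond c e + 2 * (krond a c * krond a e) + Delta * (krond a c * krond a e).
Proof.
have := @coord_moment (fun x => (x == a) + (x == a) + (x == c) + (x == e))%N.
rewrite !big_split/= !sum_pred1 => /(_ isT).
under [X in rexp _ X]eq_fun => w.
  under eq_bigr do rewrite !exprD.
  rewrite !big_split/= !prod_exp1; over.
move=> ->; rewrite /krond.
have E0 x : rexp P (fun w => coord x w ^+ 0) = 1.
  by under [X in rexp _ X]eq_fun do rewrite expr0; rewrite rexp_cst.
have [<-|ce] := eqVneq c e.
  have [<-|ac] := eqVneq a c.
    rewrite (bigD1 a)//= eqxx big1 => [|x /negPf ->]; last exact: E0.
    by rewrite coord_exp4 /=; ring.
  rewrite big1; first by rewrite /=; ring.
  move=> x _; have [->|xa] := eqVneq x a; first by rewrite (negPf ac) coord_exp2.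
  by have [->|xc] := eqVneq x c; rewrite ?coord_exp2 ?E0.
(* one of two distinct points differs from [a] and so occurs only once *)
have [ac|ac] := eqVneq a c.
  rewrite (bigD1 e)//= eqxx (eq_sym e a) ac (negPf ce) (eq_sym e c) (negPf ce).
  by rewrite coord_exp1 /=; ring.
rewrite (bigD1 c)//= eqxx (eq_sym c a) (negPf ac) (negPf ce) coord_exp1.
by rewrite /=; ring.
Qed.

(** Up to order four the coordinates of all the samples together behave like
    one vector with independent entries, whose fourth cumulant is [Delta]. *)
Lemma coord_moment4 a b c e :
  rexp P (fun w => coord a w * coord b w * coord c w * coord e w) =
  krond a b * krond c e + krond a c * krond b e + krond a e * krond b c +
  Delta * (krond a b * krond a c * krond a e).
Proof.
have dd x : krond x x = 1 by rewrite /krond eqxx.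
have dC x y : krond x y = krond y x by rewrite /krond eq_sym.
have [<-|ab] := eqVneq a b; first by rewrite coord_moment4_pair dd; ring.
have [<-|ac] := eqVneq a c.
  rewrite (_ : (fun w => _) =
      (fun w => coord a w * coord a w * coord b w * coord e w)); last first.
    by apply/funext => w; ring.
  by rewrite coord_moment4_pair dd (dC b a); ring.
have [<-|ae] := eqVneq a e.
  rewrite (_ : (fun w => _) =
      (fun w => coord a w * coord a w * coord b w * coord c w)); last first.
    by apply/funext => w; ring.
  by rewrite coord_moment4_pair dd (dC b a) (dC c a); ring.
have := @coord_moment (fun x => (x == a) + (x == b) + (x == c) + (x == e))%N.
rewrite !big_split/= !sum_pred1 => /(_ isT).
under [X in rexp _ X]eq_fun => w.
  under eq_bigr do rewrite !exprD.
  rewrite !big_split/= !prod_exp1; over.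
move=> ->; rewrite (bigD1 a)//= eqxx /krond (negPf ab) (negPf ac) (negPf ae).
by rewrite coord_exp1 /=; ring.
Qed.

End moments.

(** * Quadratic forms in the coordinates *)

Lemma cauchy_schwarz_sum (R : realDomainType) (I : finType) (x y : I -> R) :
  (\sum_i x i * y i) ^+ 2 <= (\sum_i x i ^+ 2) * (\sum_i y i ^+ 2).
Proof.
(* Lagrange's identity *)
pose S i j := x i ^+ 2 * y j ^+ 2; pose C i j := x i * y i * (x j * y j).
have : 0 <= \sum_i \sum_j (x i * y j - x j * y i) ^+ 2.
  by apply: sumr_ge0 => i _; apply: sumr_ge0 => j _; exact: sqr_ge0.
have -> : \sum_i \sum_j (x i * y j - x j * y i) ^+ 2 =
    \sum_i \sum_j S i j + \sum_i \sum_j S j i - 2 * \sum_i \sum_j C i j.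
  rewrite mulr_sumr -big_split/= -sumrB; apply: eq_bigr => i _.
  rewrite mulr_sumr -big_split/= -sumrB; apply: eq_bigr => j _.
  by rewrite /S /C; ring.
rewrite [X in _ + X - _]exchange_big/= expr2 !big_distrlr/= -/S -/C.
by lra.
Qed.

Lemma sum_exp4 (R : comRingType) (I : finType) (x : I -> R) :
  (\sum_i x i) ^+ 4 = \sum_i \sum_j \sum_k \sum_l x i * x j * x k * x l.
Proof.
rewrite -[4%N]/(2 * 2)%N exprM (expr2 (\sum_i x i)) big_distrlr/= expr2 mulr_suml.
apply: eq_bigr => i _; rewrite mulr_suml; apply: eq_bigr => j _.
rewrite mulr_sumr; apply: eq_bigr => k _; rewrite mulr_sumr.
by apply: eq_bigr => l _; rewrite mulrA.
Qed.

Section fourth_power_integrable.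
Context d (T : measurableType d) (R : realType) (P : probability T R).
Implicit Types X Y : T -> R.

Definition L4 X := measurable_fun setT X /\ rint P (fun w => X w ^+ 4).

Lemma L4_cst c : L4 (fun=> c).
Proof. by split; [exact: measurable_cst|exact: rint_cst]. Qed.

Lemma L4Z c X : L4 X -> L4 (fun w => c * X w).
Proof.
move=> [mX iX]; split; first exact: measurable_funM.
by under eq_fun do rewrite exprMn; exact: rintZ.
Qed.

Lemma L4D X Y : L4 X -> L4 Y -> L4 (fun w => X w + Y w).
Proof.
move=> [mX iX] [mY iY]; split; first exact: measurable_funD.
apply: (rint_le (Y := fun w => 8 * (X w ^+ 4 + Y w ^+ 4))).
- by apply: measurable_funX; exact: measurable_funD.
- move=> w; rewrite ger0_norm ?exprn_even_ge0// -subr_ge0.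
  have -> : 8 * (X w ^+ 4 + Y w ^+ 4) - (X w + Y w) ^+ 4 =
    (X w - Y w) ^+ 2 * (7 * (X w ^+ 2 + Y w ^+ 2) + 10 * (X w * Y w)) by ring.
  rewrite mulr_ge0 ?sqr_ge0//.
  have := sqr_ge0 (X w + Y w); have := sqr_ge0 (X w); have := sqr_ge0 (Y w).
  nra.
- by apply: rintZ; exact: rintD.
Qed.

Lemma L4_sum (I : Type) (r : seq I) (X : I -> T -> R) :
  (forall i, L4 (X i)) -> L4 (fun w => \sum_(i <- r) X i w).
Proof.
move=> LX; elim: r => [|i r IH].
  by under eq_fun do rewrite big_nil; exact: L4_cst.
by under eq_fun do rewrite big_cons; exact: L4D.
Qed.

Lemma L4_mul4 X Y X' Y' : L4 X -> L4 Y -> L4 X' -> L4 Y' ->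
  rint P (fun w => X w * Y w * X' w * Y' w).
Proof.
move=> [mX iX] [mY iY] [mX' iX'] [mY' iY'].
apply: (rint_le (Y := fun w => X w ^+ 4 + Y w ^+ 4 + (X' w ^+ 4 + Y' w ^+ 4))).
- by do 3 (apply: measurable_funM => //).
- move=> w.
  have h (x y : R) : `|x * y| <= 2^-1 * (x ^+ 2 + y ^+ 2).
    rewrite ler_norml; have := sqr_ge0 (x - y); have := sqr_ge0 (x + y).
    by move=> *; apply/andP; split; nra.
  rewrite -mulrA; apply: le_trans (h _ _) _; rewrite !exprMn.
  have h1 := h (X w ^+ 2) (Y w ^+ 2); have h2 := h (X' w ^+ 2) (Y' w ^+ 2).
  have := ler_norm (X w ^+ 2 * Y w ^+ 2); have := ler_norm (X' w ^+ 2 * Y' w ^+ 2).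
  rewrite -!exprM in h1 h2; move: h1 h2.
  have := @exprn_even_ge0 R 4 (X w) isT; have := @exprn_even_ge0 R 4 (Y w) isT.
  have := @exprn_even_ge0 R 4 (X' w) isT; have := @exprn_even_ge0 R 4 (Y' w) isT.
  by rewrite -[(2 * 2)%N]/4%N; lra.
- by do 2 (apply: rintD; try exact: rintD).
Qed.

Lemma L4_mul2 X Y : L4 X -> L4 Y -> rint P (fun w => X w * Y w).
Proof.
move=> LX LY; have := L4_mul4 LX LY (L4_cst 1) (L4_cst 1).
by under eq_fun do rewrite !mulr1.
Qed.

Lemma L4_int X : L4 X -> rint P X.
Proof.
by move=> LX; have := L4_mul2 LX (L4_cst 1); under eq_fun do rewrite mulr1.
Qed.

End fourth_power_integrable.

Section quadratic_form.
Context d (T : measurableType d) (R : realType) (P : probability T R).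
Context (I : finType) (m : nat) (Z : I -> {RV P >-> m.-tuple R}).
Context (Delta : R).
Hypothesis indZ : mutually_independent Z.
Hypothesis stdZ : forall k, centered_standardized (Z k).
Hypothesis fourthZ : forall k s,
  'E_P[(fun w => tnth (Z k w) s ^+ 4)%R]%E = (3 + Delta)%:E.
Hypothesis factorZ : forall k, mixed_moments_factor 8 (Z k).

Local Notation J := (I * 'I_m)%type.
Local Notation coord := (coord Z).
Local Notation E := (rexp P).

Definition qform (M : J -> J -> R) w :=
  \sum_a \sum_b M a b * (coord a w * coord b w).

Lemma coord_L4 a : L4 P (coord a).
Proof. by split; [exact: coord_meas|exact: (coord_int4 fourthZ)]. Qed.

Lemma sum_krond (a : J) (F : J -> R) : \sum_b krond R a b * F b = F a.
Proof.
rewrite (bigD1 a)//= big1 => [|b ba]; rewrite /krond ?eqxx ?mul1r ?addr0//.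
by rewrite eq_sym (negPf ba) mul0r.
Qed.

Lemma qform_exp M : E (qform M) = \sum_a M a a.
Proof.
have h a b : rint P (fun w => M a b * (coord a w * coord b w)).
  by apply: rintZ; exact: (coord_int_mul2 fourthZ).
rewrite rexp_sum => [|a _]; last exact: rint_sum.
apply: eq_bigr => a _; rewrite rexp_sum//.
rewrite -[RHS](sum_krond a (fun b => M a b)); apply: eq_bigr => b _.
rewrite rexpZ; last exact: (coord_int_mul2 fourthZ).
by rewrite (coord_moment2 indZ stdZ fourthZ factorZ) mulrC.
Qed.

(** The four terms come from the four products of Kronecker symbols in the
    fourth-order moments. *)
Lemma qform_sqr_exp M : rint P (fun w => qform M w ^+ 2) /\
  E (fun w => qform M w ^+ 2) =
    (\sum_a M a a) ^+ 2 + \sum_a \sum_b M a b ^+ 2 +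
    \sum_a \sum_b M a b * M b a + Delta * \sum_a M a a ^+ 2.
Proof.
have sqE w : qform M w ^+ 2 = \sum_a \sum_b \sum_c \sum_e M a b * M c e *
    (coord a w * coord b w * coord c w * coord e w).
  rewrite expr2 mulr_suml; apply: eq_bigr => a _; rewrite mulr_suml.
  apply: eq_bigr => b _; rewrite mulr_sumr; apply: eq_bigr => c _.
  by rewrite mulr_sumr; apply: eq_bigr => e _; ring.
have h a b c e : rint P (fun w => M a b * M c e *
    (coord a w * coord b w * coord c w * coord e w)).
  by apply: rintZ; exact: (coord_int_mul4 fourthZ).
under eq_fun do rewrite sqE.
split; first by do 4 (apply: rint_sum => ? _).
transitivity (\sum_a \sum_b \sum_c \sum_e M a b * M c e *
  (krond R a b * krond R c e + krond R a c * krond R b e +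
   krond R a e * krond R b c + Delta * (krond R a b * krond R a c * krond R a e))).
  rewrite rexp_sum => [|? _]; last by do 3 (apply: rint_sum => ? _).
  apply: eq_bigr => a _.
  rewrite rexp_sum => [|? _]; last by do 2 (apply: rint_sum => ? _).
  apply: eq_bigr => b _.
  rewrite rexp_sum => [|? _]; last by do 1 (apply: rint_sum => ? _).
  apply: eq_bigr => c _; rewrite rexp_sum//; apply: eq_bigr => e _.
  rewrite rexpZ; last exact: (coord_int_mul4 fourthZ).
  by rewrite (coord_moment4 indZ stdZ fourthZ factorZ).
have ce a b : \sum_c \sum_e M a b * M c e *
    (krond R a b * krond R c e + krond R a c * krond R b e +
     krond R a e * krond R b c + Delta * (krond R a b * krond R a c * krond R a e))
  = krond R a b * (M a b * \sum_c M c c) + M a b ^+ 2 + M a b * M b a +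
    Delta * (krond R a b * (M a b * M a a)).
  transitivity (\sum_c (krond R a b * (M a b * M c c) +
      krond R a c * (M a b * M c b) + krond R b c * (M a b * M c a) +
      krond R a c * (Delta * (krond R a b * (M a b * M c a))))).
    apply: eq_bigr => c _.
    rewrite -[M c c](sum_krond c) -[M c b](sum_krond b (fun e => M c e)).
    rewrite -[M c a](sum_krond a (fun e => M c e)).
    rewrite !mulr_sumr -!big_split/=; apply: eq_bigr => e _; ring.
  rewrite !big_split/= !sum_krond -!mulr_sumr; ring.
under eq_bigr => a _ do under eq_bigr => b _ do rewrite ce.
under eq_bigr => a _ do rewrite !big_split/= sum_krond -mulr_sumr sum_krond.
rewrite !big_split/= -!mulr_suml -mulr_sumr expr2.
by congr (_ + _ * _); apply: eq_bigr => a _; rewrite expr2.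
Qed.

Lemma qform_sqr_le M : (forall a b, M a b = M b a) ->
  E (fun w => qform M w ^+ 2) <=
    (\sum_a M a a) ^+ 2 + (2 + `|Delta|) * \sum_a \sum_b M a b ^+ 2.
Proof.
move=> symM; rewrite (qform_sqr_exp M).2.
have -> : \sum_a \sum_b M a b * M b a = \sum_a \sum_b M a b ^+ 2.
  by apply: eq_bigr => a _; apply: eq_bigr => b _; rewrite (symM b) expr2.
have dM : \sum_a M a a ^+ 2 <= \sum_a \sum_b M a b ^+ 2.
  apply: ler_sum => a _; rewrite (bigD1 a)//= lerDl sumr_ge0// => b _.
  exact: sqr_ge0.
have : Delta * \sum_a M a a ^+ 2 <= `|Delta| * \sum_a \sum_b M a b ^+ 2.
  apply: le_trans (_ : `|Delta| * \sum_a M a a ^+ 2 <= _).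
    by rewrite ler_wpM2r ?ler_norm// sumr_ge0// => a _; exact: sqr_ge0.
  by rewrite ler_wpM2l.
by lra.
Qed.

End quadratic_form.

(** * Stein's bound *)

Lemma sum_prod (R : nmodType) (I J : finType) (f : I * J -> R) :
  \sum_a f a = \sum_i \sum_j f (i, j).
Proof. by rewrite (pair_bigA _ (fun i j => f (i, j))); apply: eq_bigr => -[]. Qed.

Lemma sub_measurable_sum d (T : measurableType d) (R : realType)
    (G : set (set T)) (I : finType) (Q : pred I) (f : I -> T -> R) :
  (forall i, Q i -> sub_measurable G (f i)) ->
  sub_measurable G (fun w => \sum_(i | Q i) f i w).
Proof.
move=> Gf; rewrite /sub_measurable.
under [X in measurable_fun _ X]eq_fun do rewrite big_mkcond.
apply: measurable_sum => i; case: (boolP (Q i)) => Qi; first exact: Gf.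
exact: measurable_cst.
Qed.

(** The second-order Taylor bound is kept as a field next to the Lipschitz bound
    on [F'] from which it comes, so that the probabilistic part is free of
    calculus. *)
Record stein_test (R : realType) (F F' : R -> R) (c L : R) : Prop := SteinTest {
  stein_meas : measurable_fun setT F;
  stein_meas' : measurable_fun setT F';
  stein_bnd : forall x, `|F x| <= c;
  stein_bnd' : forall x, `|F' x| <= c;
  stein_lip : forall x y, `|F' x - F' y| <= L * `|x - y|;
  stein_taylor : forall x y, `|F y - F x - (y - x) * F' x| <= L * (y - x) ^+ 2
}.

Section stein_bound.
Context d (T : measurableType d) (R : realType) (P : probability T R).
Context (I : finType) (m : nat) (Z : I -> {RV P >-> m.-tuple R}).
Context (Delta : R).
Hypothesis indZ : mutually_independent Z.
Hypothesis stdZ : forall k, centered_standardized (Z k).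
Hypothesis fourthZ : forall k s,
  'E_P[(fun w => tnth (Z k w) s ^+ 4)%R]%E = (3 + Delta)%:E.
Hypothesis factorZ : forall k, mixed_moments_factor 8 (Z k).

Local Notation J := (I * 'I_m)%type.
Local Notation coord := (coord Z).
Local Notation E := (rexp P).

Variable A : J -> J -> R.
Hypothesis symA : forall a b, A a b = A b a.
Hypothesis diagA : forall a b, a.1 = b.1 -> A a b = 0.

Definition linform (a : J) w := \sum_b A a b * coord b w.
Definition increment (k : I) w := \sum_s coord (k, s) w * linform (k, s) w.
Definition cond_var (k : I) w := \sum_s linform (k, s) w ^+ 2.
Definition quad_stat w := 2^-1 * qform Z A w.
Definition deleted (k : I) w :=
  2^-1 * \sum_(a | a.1 != k) \sum_(b | b.1 != k) A a b * (coord a w * coord b w).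

Lemma sum_increment w : \sum_k increment k w = 2 * quad_stat w.
Proof.
rewrite /quad_stat mulrA divff// mul1r /qform sum_prod; apply: eq_bigr => k _.
apply: eq_bigr => s _; rewrite mulr_sumr; apply: eq_bigr => b _; ring.
Qed.

Lemma quad_stat_deleted k w : quad_stat w = deleted k w + increment k w.
Proof.
rewrite /quad_stat /deleted.
have -> : increment k w = 2^-1 * (increment k w + increment k w) by lra.
rewrite -mulrDr; congr (_ * _).
have inflE : increment k w =
    \sum_(a | a.1 == k) \sum_b A a b * (coord a w * coord b w).
  rewrite (eq_bigr (fun a => coord a w * linform a w)); last first.
    by move=> a _; rewrite mulr_sumr; apply: eq_bigr => b _; ring.
  rewrite /increment (reindex_onto (fun s => (k, s)) snd); last first.
    by move=> [i s] /= /eqP ->.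
  by apply: eq_bigl => s; rewrite !eqxx.
have inflE2 : increment k w =
    \sum_(a | a.1 != k) \sum_(b | b.1 == k) A a b * (coord a w * coord b w).
  rewrite exchange_big/= inflE; apply: eq_bigr => b /eqP bk.
  rewrite (bigID (fun a => a.1 != k))/= [X in _ + X]big1 ?addr0.
    by apply: eq_bigr => a _; rewrite symA; ring.
  by move=> a; rewrite negbK => /eqP ak; rewrite diagA ?mul0r// ak bk.
rewrite {1}inflE inflE2 /qform (bigID (fun a => a.1 == k))/= addrCA.
congr (_ + _); rewrite -big_split/=; apply: eq_bigr => a _.
by rewrite (bigID (fun b => b.1 != k))/=; congr (_ + _);
  apply: eq_bigl => b; rewrite negbK.
Qed.

Let others (k : I) : {set I} := [set~ k].

Lemma coord_others k b : b.1 != k ->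
  sub_measurable (cylinders Z (others k)) (coord b).
Proof. by move=> bk; apply: coord_sub; rewrite !inE. Qed.

Lemma linform_sub k s : sub_measurable (cylinders Z (others k)) (linform (k, s)).
Proof.
rewrite (_ : linform (k, s) = fun w => \sum_(b | b.1 != k) A (k, s) b * coord b w).
  apply: sub_measurable_sum => b bk; apply: measurable_funM => //.
  exact: coord_others.
apply/funext => w; rewrite /linform (bigID (fun b => b.1 != k))/=.
rewrite [X in _ + X]big1 ?addr0// => b; rewrite negbK => /eqP bk.
by rewrite diagA ?mul0r.
Qed.

Lemma deleted_sub k : sub_measurable (cylinders Z (others k)) (deleted k).
Proof.
apply: measurable_funM => //; apply: sub_measurable_sum => a ak.
apply: sub_measurable_sum => b bk; apply: measurable_funM => //.
by apply: measurable_funM; exact: coord_others.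
Qed.

Lemma indep_block k (X Y : T -> R) :
  sub_measurable (cylinders Z [set k]) X ->
  sub_measurable (cylinders Z (others k)) Y -> rint P X -> rint P Y ->
  rint P (fun w => X w * Y w) /\ E (fun w => X w * Y w) = E X * E Y.
Proof.
apply: rexp_indep; try exact: cylinders_measurable.
apply: cylinders_indep => //; rewrite disjoint_subset.
by apply/fintype.subsetP => x; rewrite !inE negbK.
Qed.

Lemma coord_own k s : sub_measurable (cylinders Z [set k]) (coord (k, s)).
Proof. by apply: coord_sub; rewrite inE. Qed.

Lemma linform_L4 a : L4 P (linform a).
Proof. by apply: L4_sum => b; apply: L4Z; exact: (coord_L4 fourthZ). Qed.

(** The matrix of the quadratic form [cond_var k]. *)
Definition gram (k : I) (b c : J) := \sum_s A (k, s) b * A (k, s) c.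

Lemma cond_varE k w : cond_var k w = qform Z (gram k) w.
Proof.
rewrite /qform /gram.
under eq_bigr => b _ do under eq_bigr => c _ do rewrite mulr_suml.
under eq_bigr do rewrite exchange_big/=.
rewrite exchange_big/=; apply: eq_bigr => s _.
rewrite expr2 big_distrlr/=; apply: eq_bigr => b _; apply: eq_bigr => c _; ring.
Qed.

Definition influence (k : I) := \sum_s \sum_b A (k, s) b ^+ 2.

Lemma influence_ge0 k : 0 <= influence k.
Proof. by apply: sumr_ge0 => s _; apply: sumr_ge0 => b _; exact: sqr_ge0. Qed.

Lemma tr_gram k : \sum_b gram k b b = influence k.
Proof.
by rewrite exchange_big/=; apply: eq_bigr => s _; apply: eq_bigr => b _;
  rewrite expr2.
Qed.

Lemma cond_var_exp k : E (cond_var k) = influence k.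
Proof.
rewrite (_ : cond_var k = qform Z (gram k)); last exact/funext/cond_varE.
by rewrite (qform_exp indZ stdZ fourthZ factorZ) tr_gram.
Qed.

Local Notation C := (3 + `|Delta|).

Lemma cond_var_int k : rint P (cond_var k).
Proof. by apply: rint_sum => s _; apply: L4_mul2; exact: linform_L4. Qed.

Lemma cond_var_int2 k : rint P (fun w => cond_var k w ^+ 2).
Proof.
under eq_fun do rewrite cond_varE.
exact: (qform_sqr_exp indZ stdZ fourthZ factorZ _).1.
Qed.

Lemma cond_var_sqr k : E (fun w => cond_var k w ^+ 2) <= C * influence k ^+ 2.
Proof.
under [X in E X]eq_fun do rewrite cond_varE.
apply: le_trans (qform_sqr_le indZ stdZ fourthZ factorZ _) _.
  by move=> a b; apply: eq_bigr => s _; rewrite mulrC.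
rewrite tr_gram.
have : \sum_a \sum_b gram k a b ^+ 2 <= influence k ^+ 2.
  apply: le_trans (_ : \sum_a \sum_b (\sum_s A (k, s) a ^+ 2) *
      (\sum_s A (k, s) b ^+ 2) <= _).
    by apply: ler_sum => a _; apply: ler_sum => b _; exact: cauchy_schwarz_sum.
  by rewrite expr2 /influence [X in X * _]exchange_big [X in _ * X]exchange_big/=
    big_distrlr.
by have := normr_ge0 Delta; nra.
Qed.

(** Given the other samples the increment is a linear form in the coordinates of
    sample [k], with coefficients [linform]; these coordinates are orthonormal. *)
Lemma increment_sqr_exp k (Y : T -> R) c :
  sub_measurable (cylinders Z (others k)) Y -> (forall w, `|Y w| <= c) ->
  E (fun w => increment k w ^+ 2 * Y w) = E (fun w => cond_var k w * Y w).
Proof.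
move=> sY Yc.
have mY := sub_measurable_meas (@cylinders_measurable _ _ _ _ _ _ _ _ _) sY.
have iUUY s t : rint P (fun w => linform (k, s) w * linform (k, t) w * Y w).
  apply: (rint_le (Y := fun w => c * `|linform (k, s) w * linform (k, t) w|)).
  - by do 2 (apply: measurable_funM => //); exact: (linform_L4 _).1.
  - by move=> w; rewrite normrM mulrC ler_wpM2r.
  - by apply/rintZ/rint_norm/L4_mul2; exact: linform_L4.
have ind s t : rint P (fun w => coord (k, s) w * coord (k, t) w *
      (linform (k, s) w * linform (k, t) w * Y w)) /\
    E (fun w => coord (k, s) w * coord (k, t) w *
      (linform (k, s) w * linform (k, t) w * Y w)) =
    (s == t)%:R * E (fun w => linform (k, s) w * linform (k, t) w * Y w).
  have -> : (s == t)%:R = E (fun w => coord (k, s) w * coord (k, t) w).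
    by rewrite (coord_moment2 indZ stdZ fourthZ factorZ) /krond xpair_eqE eqxx.
  apply: indep_block => //.
  - by apply: measurable_funM; exact: coord_own.
  - by do 2 (apply: measurable_funM => //); exact: linform_sub.
  - exact: (coord_int_mul2 fourthZ).
transitivity (\sum_s \sum_t E (fun w => coord (k, s) w * coord (k, t) w *
      (linform (k, s) w * linform (k, t) w * Y w))).
  under [RHS]eq_bigr => s _.
    rewrite -rexp_sum => [|t _]; last exact: (ind s t).1.
    over.
  rewrite -rexp_sum => [|s _]; last by apply: rint_sum => t _; exact: (ind s t).1.
  congr rexp; apply/funext => w; rewrite expr2 big_distrlr/= mulr_suml.
  apply: eq_bigr => s _; rewrite mulr_suml; apply: eq_bigr => t _; ring.
transitivity (\sum_s E (fun w => linform (k, s) w ^+ 2 * Y w)).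
  apply: eq_bigr => s _; rewrite (bigD1 s)//= big1 => [|t ts].
    by rewrite (ind s s).2 eqxx mul1r addr0; congr rexp; apply/funext => w; ring.
  by rewrite (ind s t).2 eq_sym (negPf ts) mul0r.
rewrite -rexp_sum => [|s _]; last exact: (iUUY s s).
by congr rexp; apply/funext => w; rewrite mulr_suml.
Qed.

(** The left-hand side is the fourth moment of the linear form with coefficients
    [x] in the coordinates of one sample, expanded by [coord_moment4]. *)
Lemma kurtosis_form (x : 'I_m -> R) :
  \sum_s \sum_t \sum_u \sum_v
    (((s == t)%:R * (u == v)%:R + (s == u)%:R * (t == v)%:R +
      (s == v)%:R * (t == u)%:R + Delta * ((s == t)%:R * (s == u)%:R * (s == v)%:R))
     * (x s * x t * x u * x v)) =
  3 * (\sum_s x s ^+ 2) ^+ 2 + Delta * \sum_s x s ^+ 4.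
Proof.
have dl s (F : 'I_m -> R) : \sum_t (s == t)%:R * F t = F s.
  rewrite (bigD1 s)//= eqxx mul1r big1 ?addr0// => t ts.
  by rewrite eq_sym (negPf ts) mul0r.
transitivity (\sum_s (3 * (x s ^+ 2 * \sum_t x t ^+ 2) + Delta * x s ^+ 4)); last first.
  by rewrite big_split/= -!mulr_sumr -mulr_suml expr2.
apply: eq_bigr => s _.
transitivity (\sum_t ((s == t)%:R * (x s * x t * \sum_u x u ^+ 2) +
   x s ^+ 2 * x t ^+ 2 + x s ^+ 2 * x t ^+ 2 +
   (s == t)%:R * (Delta * (x s ^+ 3 * x t)))); last first.
  rewrite !big_split/= !dl -mulr_sumr; ring.
apply: eq_bigr => t _.
transitivity (\sum_u ((s == t)%:R * (x s * x t * x u ^+ 2) +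
  (s == u)%:R * (x s * x t ^+ 2 * x u) + (t == u)%:R * (x s ^+ 2 * x t * x u) +
  (s == u)%:R * (Delta * ((s == t)%:R * (x s ^+ 2 * x t * x u))))); last first.
  rewrite !big_split/= !dl -!mulr_sumr; ring.
apply: eq_bigr => u _.
transitivity (\sum_v ((u == v)%:R * ((s == t)%:R * (x s * x t * x u * x v)) +
  (t == v)%:R * ((s == u)%:R * (x s * x t * x u * x v)) +
  (s == v)%:R * ((t == u)%:R * (x s * x t * x u * x v)) +
  (s == v)%:R * (Delta * ((s == t)%:R * (s == u)%:R * (x s * x t * x u * x v)))));
  last by rewrite !big_split/= !dl; ring.
by apply: eq_bigr => v _; ring.
Qed.

(** Conditionally on the other samples, the fourth moment of a linear form in
    uncorrelated coordinates is at most [3 + `|Delta|] times the square of its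
    variance. *)
Lemma increment_exp4 k : rint P (fun w => increment k w ^+ 4) /\
  E (fun w => increment k w ^+ 4) <= C * E (fun w => cond_var k w ^+ 2).
Proof.
pose M4 (s t u v : 'I_m) : R :=
  (s == t)%:R * (u == v)%:R + (s == u)%:R * (t == v)%:R +
  (s == v)%:R * (t == u)%:R + Delta * ((s == t)%:R * (s == u)%:R * (s == v)%:R).
pose z s w := coord (k, s) w; pose x s w := linform (k, s) w.
have ix s t u v : rint P (fun w => x s w * x t w * x u w * x v w).
  by apply: L4_mul4; exact: linform_L4.
have ind (s t u v : 'I_m) :
    rint P (fun w => (z s w * z t w * z u w * z v w) *
                     (x s w * x t w * x u w * x v w)) /\
    E (fun w => (z s w * z t w * z u w * z v w) *
                     (x s w * x t w * x u w * x v w)) =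
    M4 s t u v * E (fun w => x s w * x t w * x u w * x v w).
  have -> : M4 s t u v = E (fun w => z s w * z t w * z u w * z v w).
    rewrite (coord_moment4 indZ stdZ fourthZ factorZ) /krond !xpair_eqE !eqxx/=.
    by [].
  apply: indep_block => //.
  - by do 3 (apply: measurable_funM; last exact: coord_own); exact: coord_own.
  - by do 3 (apply: measurable_funM; last exact: linform_sub); exact: linform_sub.
  - exact: (coord_int_mul4 fourthZ).
have E4 w : increment k w ^+ 4 = \sum_s \sum_t \sum_u \sum_v
    (z s w * z t w * z u w * z v w) * (x s w * x t w * x u w * x v w).
  rewrite sum_exp4; do 4 (apply: eq_bigr => ? _); rewrite /z /x; ring.
have iM s t u v : rint P (fun w => M4 s t u v * (x s w * x t w * x u w * x v w)).
  exact: rintZ.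
have -> : (fun w => increment k w ^+ 4) = (fun w => \sum_s \sum_t \sum_u \sum_v
    (z s w * z t w * z u w * z v w) * (x s w * x t w * x u w * x v w)).
  exact/funext/E4.
have i4 s t u v := (ind s t u v).1.
split; first by do 4 (apply: rint_sum => ? _).
have -> : E (fun w => \sum_s \sum_t \sum_u \sum_v
    (z s w * z t w * z u w * z v w) * (x s w * x t w * x u w * x v w)) =
  E (fun w => \sum_s \sum_t \sum_u \sum_v M4 s t u v * (x s w * x t w * x u w * x v w)).
  rewrite !rexp_sum => [|? _|? _]; try by do 3 (apply: rint_sum => ? _).
  apply: eq_bigr => s _.
  rewrite !rexp_sum => [|? _|? _]; try by do 2 (apply: rint_sum => ? _).
  apply: eq_bigr => t _.
  rewrite !rexp_sum => [|? _|? _]; try by do 1 (apply: rint_sum => ? _).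
  apply: eq_bigr => u _; rewrite !rexp_sum => [|? _|? _]//.
  by apply: eq_bigr => v _; rewrite (ind s t u v).2 rexpZ.
rewrite -rexpZ; last exact: cond_var_int2.
apply: rexp_le; [by do 4 (apply: rint_sum => ? _)|exact/rintZ/cond_var_int2|move=> w].
rewrite kurtosis_form /cond_var.
have x4 : \sum_s x s w ^+ 4 <= (\sum_s linform (k, s) w ^+ 2) ^+ 2.
  rewrite [X in _ <= X]expr2 mulr_suml; apply: ler_sum => s _.
  rewrite (bigD1 s)//= mulrDr -expr2 -exprM lerDl mulr_ge0 ?sqr_ge0// sumr_ge0//.
  by move=> t _; exact: sqr_ge0.
have x40 : 0 <= \sum_s x s w ^+ 4.
  by apply: sumr_ge0 => s _; exact: exprn_even_ge0.
have := ler_norm Delta; have := normr_ge0 Delta.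
by rewrite -/(x _ w); nra.
Qed.

Lemma increment_meas k : measurable_fun setT (increment k).
Proof.
apply: measurable_sum => s; apply: measurable_funM; first exact: coord_meas.
exact: (linform_L4 _).1.
Qed.

Lemma increment_L4 k : L4 P (increment k).
Proof. by split; [exact: increment_meas|exact: (increment_exp4 k).1]. Qed.

Lemma increment_exp2 k : E (fun w => increment k w ^+ 2) = influence k.
Proof.
have s1 : sub_measurable (cylinders Z (others k)) (fun=> 1 : R).
  exact: measurable_cst.
rewrite -cond_var_exp; transitivity (E (fun w => increment k w ^+ 2 * 1)).
  by congr rexp; apply/funext => w; rewrite mulr1.
rewrite (increment_sqr_exp s1 (c := 1)) => [|w]; last by rewrite normr1.
by congr rexp; apply/funext => w; rewrite mulr1.
Qed.

Lemma increment_exp_mul k (Y : T -> R) c :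
  sub_measurable (cylinders Z (others k)) Y -> (forall w, `|Y w| <= c) ->
  E (fun w => increment k w * Y w) = 0.
Proof.
move=> sY Yc.
have mY := sub_measurable_meas (@cylinders_measurable _ _ _ _ _ _ _ _ _) sY.
have ind s : rint P (fun w => coord (k, s) w * (linform (k, s) w * Y w)) /\
    E (fun w => coord (k, s) w * (linform (k, s) w * Y w)) = 0.
  rewrite -[RHS](mul0r (E (fun w => linform (k, s) w * Y w))).
  rewrite -[X in _ = X * _](coord_exp1 stdZ fourthZ (k, s)).
  apply: indep_block.
  - exact: coord_own.
  - by apply: measurable_funM => //; exact: linform_sub.
  - exact/L4_int/(coord_L4 fourthZ).
  - apply: (rint_le (Y := fun w => c * `|linform (k, s) w|)).
    + by apply: measurable_funM => //; exact: (linform_L4 _).1.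
    + by move=> w; rewrite normrM mulrC ler_wpM2r.
    + exact/rintZ/rint_norm/L4_int/linform_L4.
rewrite (_ : (fun w => _) = fun w => \sum_s coord (k, s) w * (linform (k, s) w * Y w)).
  by rewrite rexp_sum => [|s _]; [rewrite big1// => s _; exact: (ind s).2|
    exact: (ind s).1].
by apply/funext => w; rewrite mulr_suml; apply: eq_bigr => s _; rewrite mulrA.
Qed.

Lemma quad_stat_exp : E quad_stat = 0.
Proof.
rewrite rexpZ.
  rewrite (qform_exp indZ stdZ fourthZ factorZ) big1 ?mulr0// => a _.
  exact: diagA.
apply: rint_sum => a _; apply: rint_sum => b _.
exact/rintZ/(coord_int_mul2 fourthZ).
Qed.

Lemma quad_stat_int2 : rint P (fun w => quad_stat w ^+ 2).
Proof.
under eq_fun do rewrite exprMn.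
exact/rintZ/(qform_sqr_exp indZ stdZ fourthZ factorZ _).1.
Qed.

Lemma quad_stat_exp2 :
  E (fun w => quad_stat w ^+ 2) = 2^-1 * \sum_a \sum_b A a b ^+ 2.
Proof.
have [iq qE] := qform_sqr_exp indZ stdZ fourthZ factorZ A.
under [X in E X]eq_fun do rewrite exprMn.
rewrite rexpZ// qE big1 => [|a _]; last exact: diagA.
rewrite [X in Delta * X]big1 => [|a _]; last by rewrite diagA ?expr0n.
have -> : \sum_a \sum_b A a b * A b a = \sum_a \sum_b A a b ^+ 2.
  by apply: eq_bigr => a _; apply: eq_bigr => b _; rewrite (symA b) expr2.
rewrite expr0n/=; lra.
Qed.

Lemma quad_stat_meas : measurable_fun setT quad_stat.
Proof.
apply: measurable_funM => //; apply: measurable_sum => a.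
apply: measurable_sum => b; apply: measurable_funM => //.
by apply: measurable_funM; exact: coord_meas.
Qed.

Definition sq_kernel (b c : J) := \sum_a A b a * A a c.

Hypothesis normA : \sum_a \sum_b A a b ^+ 2 = 2.

Lemma sum_influence : \sum_k influence k = 2.
Proof. by rewrite -normA sum_prod. Qed.

Lemma cond_var_concentration :
  rint P (fun w => (2^-1 * (\sum_k cond_var k w) - 1) ^+ 2) /\
  E (fun w => (2^-1 * (\sum_k cond_var k w) - 1) ^+ 2) <=
    4^-1 * (2 + `|Delta|) * \sum_b \sum_c sq_kernel b c ^+ 2.
Proof.
have HE w : \sum_k cond_var k w = qform Z sq_kernel w.
  under eq_bigr do rewrite cond_varE /qform.
  rewrite exchange_big/=; apply: eq_bigr => b _.
  rewrite exchange_big/=; apply: eq_bigr => c _.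
  rewrite -mulr_suml; congr (_ * _); rewrite /sq_kernel sum_prod.
  by apply: eq_bigr => k _; apply: eq_bigr => s _; rewrite symA.
have trA : \sum_b sq_kernel b b = 2.
  rewrite -normA; apply: eq_bigr => b _; apply: eq_bigr => c _.
  by rewrite symA expr2.
have [iq qE] := qform_sqr_exp indZ stdZ fourthZ factorZ sq_kernel.
have iq1 : rint P (qform Z sq_kernel).
  apply: rint_sum => a _; apply: rint_sum => b _.
  exact/rintZ/(coord_int_mul2 fourthZ).
have E1 := qform_exp indZ stdZ fourthZ factorZ sq_kernel.
have qle := @qform_sqr_le _ _ _ _ _ _ _ _ indZ stdZ fourthZ factorZ sq_kernel.
rewrite (_ : (fun w => _) =
    (fun w => 4^-1 * qform Z sq_kernel w ^+ 2 + (1 - qform Z sq_kernel w))); last first.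
  by apply/funext => w; rewrite HE; field.
have i1 : rint P (fun w => 1 - qform Z sq_kernel w).
  by apply: rintB => //; exact: rint_cst.
split; first by apply: rintD => //; exact: rintZ.
rewrite rexpD//; last exact: rintZ.
rewrite rexpZ// rexpB//; last exact: rint_cst.
rewrite rexp_cst E1 trA.
have /qle : forall a b, sq_kernel a b = sq_kernel b a.
  by move=> a b; apply: eq_bigr => c _; rewrite mulrC symA [X in _ * X]symA.
rewrite trA; lra.
Qed.

Variables (F F' : R -> R) (c L : R).
Hypothesis FF' : stein_test F F' c L.
Hypothesis L0 : 0 <= L.

Let c0 : 0 <= c. Proof. by apply: le_trans (stein_bnd FF' 0). Qed.

(** Both expectations are compared with their analogues at the statistic without
    sample [k]: there the first one vanishes, and the second one equals
    [E ((increment k)^2 F'(deleted k))] by conditioning. *)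
Lemma increment_stein k e : 0 < e ->
  `|E (fun w => increment k w * F (quad_stat w)) -
    E (fun w => cond_var k w * F' (quad_stat w))| <=
  L * (e * influence k + (C ^+ 2 + C) / 2 / e * influence k ^+ 2).
Proof.
move=> e0.
have mT := quad_stat_meas; have mQ := increment_meas k.
have mS := sub_measurable_meas (@cylinders_measurable _ _ _ _ _ _ _ _ _)
  (@deleted_sub k).
have mF (X : T -> R) : measurable_fun setT X -> measurable_fun setT (F \o X).
  by move=> mX; apply: measurableT_comp mX; exact: (stein_meas FF').
have mF' (X : T -> R) : measurable_fun setT X -> measurable_fun setT (F' \o X).
  by move=> mX; apply: measurableT_comp mX; exact: (stein_meas' FF').
have mH := rint_meas (cond_var_int k).
have iQ := L4_int (increment_L4 k).
have iQ2 : rint P (fun w => increment k w ^+ 2).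
  exact: L4_mul2 (increment_L4 k) (increment_L4 k).
have H0 w : 0 <= cond_var k w by apply: sumr_ge0 => s _; exact: sqr_ge0.
have bnd (X Y : T -> R) : rint P X -> measurable_fun setT Y ->
    (forall w, `|Y w| <= c) -> rint P (fun w => X w * Y w).
  move=> iX mY Yc; apply: (rint_le (Y := fun w => c * `|X w|)).
  - by apply: measurable_funM => //; exact: rint_meas iX.
  - by move=> w; rewrite normrM mulrC ler_wpM2r.
  - exact/rintZ/rint_norm.
have bF w : `|F (quad_stat w)| <= c by exact: (stein_bnd FF').
have bF' (X : T -> R) w : `|F' (X w)| <= c by exact: (stein_bnd' FF').
have iQF := bnd _ _ iQ (mF _ mT) bF.
have iQFS : rint P (fun w => increment k w * F (deleted k w)).
  by apply: bnd (mF _ mS) _ => // w; exact: (stein_bnd FF').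
have iHFT := bnd _ _ (cond_var_int k) (mF' _ mT) (bF' _).
have iHFS := bnd _ _ (cond_var_int k) (mF' _ mS) (bF' _).
have iQ2F := bnd _ _ iQ2 (mF' _ mS) (bF' _).
have z1 : E (fun w => increment k w * F (deleted k w)) = 0.
  apply: (increment_exp_mul (c := c)) => [|w]; last exact: (stein_bnd FF').
  apply: measurableT_comp (@deleted_sub k); exact: (stein_meas FF').
have z2 : E (fun w => increment k w ^+ 2 * F' (deleted k w)) =
          E (fun w => cond_var k w * F' (deleted k w)).
  apply: (increment_sqr_exp (c := c)) => [|w]; last exact: (stein_bnd' FF').
  apply: measurableT_comp (@deleted_sub k); exact: (stein_meas' FF').
have -> : E (fun w => increment k w * F (quad_stat w)) -
  E (fun w => cond_var k w * F' (quad_stat w)) =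
  E (fun w => increment k w * F (quad_stat w) - increment k w * F (deleted k w) -
    increment k w ^+ 2 * F' (deleted k w) +
    (cond_var k w * F' (deleted k w) - cond_var k w * F' (quad_stat w))).
  rewrite rexpD; [|by apply: rintB => //; exact: rintB|exact: rintB].
  rewrite !rexpB//; last exact: rintB.
  rewrite z1 z2; ring.
pose B w := e / 2 * increment k w ^+ 2 + 2^-1 / e * increment k w ^+ 4 +
   (e / 2 * increment k w ^+ 2 + 2^-1 / e * cond_var k w ^+ 2).
have iB : rint P B.
  by apply: rintD; apply: rintD; apply: rintZ => //;
    [exact: (increment_exp4 k).1|exact: cond_var_int2].
apply: le_trans (rexp_norm_le (Y := fun w => L * B w) _ _ _) _.
- apply: measurable_funD; apply: measurable_funB;
    try (by apply: measurable_funB; apply: measurable_funM => //;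
      [exact: mF|exact: mF]);
    apply: measurable_funM => //; try exact: mF'; exact: measurable_funX.
- exact: rintZ.
- move=> w; set q := increment k w; set h := cond_var k w; set s := deleted k w.
  have TE : quad_stat w = s + q by exact: quad_stat_deleted.
  have := stein_taylor FF' s (quad_stat w); have := stein_lip FF' s (quad_stat w).
  rewrite TE [s + q - s]addrC addKr opprD addNKr normrN => hl ht.
  have -> : q * F (s + q) - q * F s - q ^+ 2 * F' s + (h * F' s - h * F' (s + q)) =
    q * (F (s + q) - F s - q * F' s) + h * (F' s - F' (s + q)) by ring.
  apply: le_trans (ler_normD _ _) _; rewrite !normrM (ger0_norm (H0 w)).
  have q0 := normr_ge0 q.
  have q2 : q ^+ 2 = `|q| ^+ 2 by rewrite real_normK// num_real.
  have q4 : q ^+ 4 = `|q| ^+ 4 by rewrite -[4%N]/(2 * 2)%N !exprM q2.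
  apply: le_trans (_ : L * (`|q| ^+ 3 + h * `|q|) <= _).
    rewrite q2 in ht; have := ler_wpM2l q0 ht; have := ler_wpM2l (H0 w) hl.
    rewrite -/h; rewrite (exprS _ 2); lra.
  apply: ler_wpM2l => //; rewrite /B -/q -/h q2 q4.
  (* the arithmetic-geometric inequality with weight [e] *)
  have ei : 0 < e^-1 by rewrite invr_gt0.
  have amgm (x y : R) : x * y <= e / 2 * x ^+ 2 + 2^-1 / e * y ^+ 2.
    have := sqr_ge0 (e * x - y); rewrite -(pmulr_rge0 _ ei) => hh.
    have -> : e / 2 * x ^+ 2 + 2^-1 / e * y ^+ 2 =
      2^-1 * (e^-1 * (e * x - y) ^+ 2) + x * y by field; rewrite gt_eqF.
    by rewrite lerDr mulr_ge0.
  have := amgm `|q| (`|q| ^+ 2); have := amgm `|q| h.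
  rewrite -exprS -exprM [h * _]mulrC; lra.
rewrite rexpZ// ler_wpM2l// /B.
rewrite !rexpD ?rexpZ//; try exact: rintZ; try (by exact: (increment_exp4 k).1);
  try exact: cond_var_int2; try (by apply/rintZ; exact: (increment_exp4 k).1);
  try (by apply/rintZ; exact: cond_var_int2);
  try (by apply: rintD; apply: rintZ => //; exact: (increment_exp4 k).1);
  try (by apply: rintD; apply: rintZ => //; exact: cond_var_int2).
rewrite increment_exp2.
have h4 := (increment_exp4 k).2; have h2 := cond_var_sqr k.
have C0 : 0 <= C by rewrite addr_ge0.
have ei : 0 < e^-1 by rewrite invr_gt0.
have h4' : E (fun w => increment k w ^+ 4) <= C * (C * influence k ^+ 2).
  by apply: le_trans h4 _; rewrite ler_wpM2l.
have := ler_wpM2l (ltW ei) h4'; have := ler_wpM2l (ltW ei) h2.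
lra.
Qed.

Lemma stein_bound e v w : 0 < e -> (forall k, influence k <= v) ->
  \sum_b \sum_c sq_kernel b c ^+ 2 <= w ->
  `|E (fun x => F' (quad_stat x) - quad_stat x * F (quad_stat x))| <=
  L * (e + (C ^+ 2 + C) / 2 / e * v) + c * (e / 2 + (2 + `|Delta|) / 8 / e * w).
Proof.
move=> e0 Vv Aw.
have mT := quad_stat_meas.
have mFT : measurable_fun setT (fun x => F (quad_stat x)).
  by apply: measurableT_comp mT; exact: (stein_meas FF').
have mFT' : measurable_fun setT (fun x => F' (quad_stat x)).
  by apply: measurableT_comp mT; exact: (stein_meas' FF').
have bnd (X Y : T -> R) : rint P X -> measurable_fun setT Y ->
    (forall w, `|Y w| <= c) -> rint P (fun w => X w * Y w).
  move=> iX mY Yc; apply: (rint_le (Y := fun w => c * `|X w|)).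
  - by apply: measurable_funM => //; exact: rint_meas iX.
  - by move=> x; rewrite normrM mulrC ler_wpM2r.
  - exact/rintZ/rint_norm.
have iQF k := bnd _ _ (L4_int (increment_L4 k)) mFT
  (fun x => stein_bnd FF' (quad_stat x)).
have iHF k := bnd _ _ (cond_var_int k) mFT' (fun x => stein_bnd' FF' (quad_stat x)).
have iF' : rint P (fun x => F' (quad_stat x)).
  by apply: (@rint_bounded _ _ _ P _ c mFT') => x; exact: (stein_bnd' FF').
have iTF : rint P (fun x => quad_stat x * F (quad_stat x)).
  rewrite (_ : (fun x => _) = fun x => 2^-1 * \sum_k increment k x * F (quad_stat x)).
    by apply: rintZ; apply: rint_sum => k _; exact: iQF.
  by apply/funext => x; rewrite -mulr_suml sum_increment; field.
have -> : E (fun x => F' (quad_stat x) - quad_stat x * F (quad_stat x)) =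
  E (fun x => (1 - 2^-1 * \sum_k cond_var k x) * F' (quad_stat x)) -
  2^-1 * \sum_k (E (fun x => increment k x * F (quad_stat x)) -
                E (fun x => cond_var k x * F' (quad_stat x))).
  rewrite sumrB -!rexp_sum => [|k _|k _]//.
  rewrite (_ : (fun x => (1 - 2^-1 * \sum_k cond_var k x) * F' (quad_stat x)) =
    fun x => F' (quad_stat x) -
      2^-1 * \sum_k cond_var k x * F' (quad_stat x)); last first.
    by apply/funext => x; rewrite -mulr_suml; ring.
  have iHs : rint P (fun x => \sum_k cond_var k x * F' (quad_stat x)).
    by apply: rint_sum => k _; exact: iHF.
  have iQs : rint P (fun x => \sum_k increment k x * F (quad_stat x)).
    by apply: rint_sum => k _; exact: iQF.
  rewrite (_ : (fun x => F' (quad_stat x) - quad_stat x * F (quad_stat x)) =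
    fun x => F' (quad_stat x) -
      2^-1 * \sum_k increment k x * F (quad_stat x)); last first.
    by apply/funext => x; rewrite -mulr_suml sum_increment; field.
  rewrite !rexpB//; try exact: rintZ.
  rewrite !rexpZ//; ring.
have [iC Cle] := cond_var_concentration.
have ei : 0 < e^-1 by rewrite invr_gt0.
have b1 : `|E (fun x => (1 - 2^-1 * \sum_k cond_var k x) * F' (quad_stat x))| <=
    c * (e / 2 + (2 + `|Delta|) / 8 / e * w).
  apply: le_trans (rexp_norm_le (Y := fun x => c * (e / 2 + 2^-1 / e *
      (2^-1 * (\sum_k cond_var k x) - 1) ^+ 2)) _ _ _) _.
  - apply: measurable_funM => //; apply: measurable_funB => //.
    apply: measurable_funM => //; apply: measurable_sum => k.
    exact: rint_meas (cond_var_int k).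
  - by apply: rintZ; apply: rintD; [exact: rint_cst|exact: rintZ].
  - move=> x; rewrite normrM mulrC; set h := _ - 1.
    apply: ler_pM => //; first exact: (stein_bnd' FF').
    rewrite distrC; rewrite -/h.
    have -> : e / 2 + 2^-1 / e * h ^+ 2 =
        2^-1 * (e^-1 * (e - `|h|) ^+ 2) + `|h|.
      have -> : h ^+ 2 = `|h| ^+ 2 by rewrite real_normK// num_real.
      by field; rewrite gt_eqF.
    by rewrite lerDr mulr_ge0// mulr_ge0 ?sqr_ge0// ltW.
  rewrite rexpZ; last by apply: rintD; [exact: rint_cst|exact: rintZ].
  rewrite rexpD; [|exact: rint_cst|exact: rintZ].
  rewrite rexp_cst rexpZ// ler_wpM2l// lerD2l.
  have D0 : 0 <= 4^-1 * (2 + `|Delta|) by rewrite mulr_ge0// addr_ge0.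
  have := ler_wpM2l (ltW ei) (le_trans Cle (ler_wpM2l D0 Aw)); lra.
have b2 : `|2^-1 * \sum_k (E (fun x => increment k x * F (quad_stat x)) -
      E (fun x => cond_var k x * F' (quad_stat x)))| <=
    L * (e + (C ^+ 2 + C) / 2 / e * v).
  rewrite normrM ger0_norm//.
  set D := (C ^+ 2 + C) / 2 / e.
  have D0 : 0 <= D.
    by rewrite !mulr_ge0 ?ltW// addr_ge0 ?sqr_ge0// addr_ge0.
  have : \sum_k `|E (fun x => increment k x * F (quad_stat x)) -
      E (fun x => cond_var k x * F' (quad_stat x))| <=
      \sum_k (L * (e + D * v)) * influence k.
    apply: ler_sum => k _; apply: le_trans (increment_stein k e0) _; rewrite -/D.
    have V0 := influence_ge0 k; rewrite -mulrA ler_wpM2l//.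
    have := ler_wpM2r V0 (ler_wpM2l D0 (Vv k)); rewrite expr2; lra.
  rewrite -mulr_sumr sum_influence => hs.
  have := ler_norm_sum (index_enum I) (fun k =>
    E (fun x => increment k x * F (quad_stat x)) -
    E (fun x => cond_var k x * F' (quad_stat x)))
    xpredT.
  lra.
by apply: le_trans (ler_normB _ _) _; lra.
Qed.

End stein_bound.

(** * Stein's equation *)

Section real_calculus.
Context (R : realType).
Implicit Types f g : R -> R.

Lemma derivM f g (x a b : R) : is_derive x 1 f a -> is_derive x 1 g b ->
  is_derive x 1 (fun y => f y * g y) (a * g x + f x * b).
Proof.
move=> fa gb; apply: is_derive_eq (is_deriveM fa gb) _.
by rewrite /GRing.scale/=; ring.
Qed.

Lemma derivD f g (x a b : R) : is_derive x 1 f a -> is_derive x 1 g b ->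
  is_derive x 1 (fun y => f y + g y) (a + b).
Proof. by move=> fa gb; exact: is_deriveD. Qed.

Lemma derivV f (x a : R) : f x != 0 -> is_derive x 1 f a ->
  is_derive x 1 (fun y => (f y)^-1) (- a / f x ^+ 2).
Proof.
move=> f0 fa; apply: is_derive_eq (is_deriveV f0 fa) _.
by rewrite /GRing.scale/=; ring.
Qed.

Lemma deriv_continuous f (f' : R -> R) :
  (forall x : R, is_derive x 1 f (f' x)) -> continuous f.
Proof.
move=> df x; apply: differentiable_continuous; apply/derivable1_diffP.
by have [] := df x.
Qed.

Lemma mean_value f (f' : R -> R) : (forall x : R, is_derive x 1 f (f' x)) ->
  forall x y, exists2 c, `|c - x| <= `|y - x| & f y - f x = f' c * (y - x).
Proof.
move=> df x y.
have cf := deriv_continuous df.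
have [xy|yx] := leP x y.
  have [|c] := MVT_segment xy (fun z _ => df z); first exact: continuous_subspaceT.
  rewrite in_itv/= => /andP[xc cy] E; exists c => //.
  by rewrite !ger0_norm ?subr_ge0//; lra.
have [|c] := MVT_segment (ltW yx) (fun z _ => df z).
  exact: continuous_subspaceT.
rewrite in_itv/= => /andP[yc cx] E; exists c.
  by rewrite !ler0_norm ?subr_le0 ?(ltW yx)//; lra.
by rewrite -opprB E -mulrN opprB.
Qed.

Lemma deriv_bounded_lipschitz f (f' : R -> R) L :
  (forall x : R, is_derive x 1 f (f' x)) -> (forall x, `|f' x| <= L) ->
  forall x y, `|f x - f y| <= L * `|x - y|.
Proof.
move=> df bf x y; have [c _ ->] := mean_value df y x.
by rewrite normrM ler_wpM2r.
Qed.

Lemma lipschitz_continuous f L : (forall x y, `|f x - f y| <= L * `|x - y|) ->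
  continuous f.
Proof.
move=> Lf x.
have L0 : 0 <= L by have := Lf 1 0; rewrite subr0 normr1 mulr1; exact: le_trans.
apply/cvgrPdist_le => /= e e0; near=> y.
apply: le_trans (Lf _ _) _; apply: le_trans (_ : (L + 1) * `|x - y| <= _).
  by rewrite ler_wpM2r// lerDl.
rewrite -ler_pdivlMl ?ltr_wpDl//; near: y.
by apply: (cvgr_dist_le id x (@cvg_id _ (nbhs x)));
  rewrite mulr_gt0// invr_gt0 ltr_wpDl.
Unshelve. all: by end_near. Qed.

Lemma lipschitz_taylor f (f' : R -> R) L :
  (forall x : R, is_derive x 1 f (f' x)) -> 
  (forall x y, `|f' x - f' y| <= L * `|x - y|) ->
  forall x y, `|f y - f x - (y - x) * f' x| <= L * (y - x) ^+ 2.
Proof.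
move=> df Lf x y; have [c cx ->] := mean_value df x y.
have L0 : 0 <= L by have := Lf 1 0; rewrite subr0 normr1 mulr1; exact: le_trans.
rewrite [f' c * _]mulrC -mulrBr normrM -(@real_normK _ (y - x)) ?num_real//.
rewrite expr2 mulrCA ler_wpM2l//; apply: le_trans (Lf _ _) _.
by rewrite ler_wpM2l.
Qed.

End real_calculus.

Section stein_equation.
Context (R : realType).
Local Notation leb := (@lebesgue_measure R).
Local Notation phi := (@normal_pdf R 0 1).
Local Notation peak := (@normal_peak R 1).

Lemma phiE (x : R) : phi x = peak * expR (- x ^+ 2 / 2).
Proof.
rewrite normal_pdfE ?oner_neq0// /normal_fun subr0 expr1n.
by [].
Qed.

Lemma peak_gt0 : 0 < peak. Proof. by rewrite normal_peak_gt0// oner_neq0. Qed.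

Lemma phi_gt0 (x : R) : 0 < phi x.
Proof. by rewrite phiE mulr_gt0 ?expR_gt0 ?peak_gt0. Qed.

Lemma phi_deriv (x : R) : is_derive x 1 phi (- x * phi x).
Proof.
rewrite (_ : phi = fun y => peak * expR (- y ^+ 2 / 2)); last exact/funext/phiE.
have d1 : is_derive x (1 : R) (fun y : R => - y ^+ 2 / 2) (- x).
  have h (k : R) : is_derive x (1 : R) (fun y : R => k * (y * y)) (2 * k * x).
    apply: is_derive_eq (derivM (is_derive_cst _ _ _)
      (derivM (is_derive_id _ _) (is_derive_id _ _))) _.
    by rewrite /cst; ring.
  have -> : (fun y : R => - y ^+ 2 / 2) = (fun y => (- 2^-1) * (y * y)).
    by apply/funext => y; field.
  by apply: is_derive_eq (h _) _; field.
pose u (y : R) : R := - y ^+ 2 / 2.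
have d2 := @is_derive1_comp _ expR u x _ _ (is_derive_expR (u x)) d1.
apply: is_derive_eq (derivM (is_derive_cst _ _ _) d2) _.
by rewrite mul0r add0r /cst mulrA mulrC.
Qed.

(** The cross term in [t ^+ 2 = x ^+ 2 + (t - x) ^+ 2 + 2 * (x * (t - x))] is
    nonnegative on the side of [x] away from 0. *)
Lemma phi_shift (x t : R) : 0 <= x * (t - x) ->
  phi t <= phi x / peak * normal_pdf x 1 t.
Proof.
move=> xt; rewrite !phiE normal_pdfE ?oner_neq0// /normal_fun expr1n.
have p0 := peak_gt0.
rewrite [peak * expR (- x ^+ 2 / 2)]mulrC mulfK ?gt_eqF// mulrCA ler_wpM2l ?(ltW p0)//.
rewrite -expRD ler_expR -[1 *+ 2]/(2 : R).
nra.
Qed.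

Variables (h : R -> R) (K : R).
Hypothesis h01 : forall x, 0 <= h x <= 1.
Hypothesis hlip : forall x y, `|h x - h y| <= K * `|x - y|.

Definition gauss_mean (u : R -> R) : R := \int[leb]_x (u x * phi x).

Let g x := h x - gauss_mean h.

Lemma phi_int (A : set R) : measurable A -> leb.-integrable A (EFin \o phi).
Proof.
by move=> mA; apply: integrableS (integrable_normal_pdf 0 1).
Qed.

Let hc : continuous h. Proof. exact: lipschitz_continuous hlip. Qed.

Lemma bounded_phi_int (u : R -> R) c (A : set R) : measurable A ->
  measurable_fun setT u ->
  (forall x, `|u x| <= c) -> leb.-integrable A (EFin \o (fun x => u x * phi x)).
Proof.
move=> mA mu uc.
have c0 : 0 <= c by exact: le_trans (uc 0).
apply: (integrableS measurableT) => //.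
have i1 : leb.-integrable setT (fun x => (c * phi x)%:E).
  exact: (integrableZl measurableT c (integrable_normal_pdf 0 1)).
apply: le_integrable i1 => //.
  apply/measurable_EFinP; apply: measurable_funM => //.
  exact: measurable_normal_pdf.
move=> x _; rewrite /= lee_fin !normrM (ger0_norm c0).
by rewrite ler_wpM2r.
Qed.

Let mh : measurable_fun setT h. Proof. exact: continuous_measurable_fun. Qed.

Let hb x : `|h x| <= 1.
Proof. by have /andP[h0 h1] := h01 x; rewrite ger0_norm. Qed.

Lemma phi_mass : \int[leb]_x phi x = 1.
Proof. by rewrite /Rintegral integral_normal_pdf. Qed.

Lemma gauss_mean01 : 0 <= gauss_mean h <= 1.
Proof.
apply/andP; split.
  apply: Rintegral_ge0 => x _; have /andP[h0 _] := h01 x.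
  by rewrite mulr_ge0// ltW// phi_gt0.
rewrite -phi_mass; apply: le_Rintegral => //.
- exact: (bounded_phi_int measurableT mh hb).
- exact: phi_int.
- move=> x _; have /andP[_ h1] := h01 x.
  by rewrite ler_piMl// ltW// phi_gt0.
Qed.

Lemma centred_bound x : `|g x| <= 1.
Proof.
have /andP[h0 h1] := h01 x; have /andP[m0 m1] := gauss_mean01.
by rewrite ler_norml /g; apply/andP; split; lra.
Qed.

Let gc : continuous g.
Proof. by move=> x; apply: cvgB; [exact: hc|exact: cvg_cst]. Qed.

Let mg : measurable_fun setT g. Proof. exact: continuous_measurable_fun. Qed.

Let ig (A : set R) : measurable A ->
  leb.-integrable A (EFin \o (fun x => g x * phi x)).
Proof. by move=> mA; exact: (bounded_phi_int mA mg centred_bound). Qed.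

Lemma centred_total : \int[leb]_x (g x * phi x) = 0.
Proof.
under eq_Rintegral do rewrite mulrBl.
rewrite RintegralB//; last 2 first.
- exact: (bounded_phi_int measurableT mh hb).
- apply: (bounded_phi_int (c := `|gauss_mean h|) measurableT) => //.
rewrite RintegralZl//; last exact: phi_int.
by rewrite phi_mass mulr1 subrr.
Qed.

(** Dividing by [phi] will turn the derivative [g * phi] of this function into
    the right-hand side of Stein's equation. *)
Definition primitive (x : R) : R :=
  \int[leb]_(t in [set` `]-oo, x]]) (g t * phi t).

Lemma primitive_deriv (x : R) : is_derive x 1 primitive (g x * phi x).
Proof.
have /= := @continuous_FTC1 R (fun t => g t * phi t) (BInfty _ true) x (x + 1).
have -> : x < x + 1 by rewrite ltrDl.
move=> /(_ isT (ig _)) [//||| d1 d2].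
- exact: ltNyr.
- apply: cvgM; first exact: gc.
  by apply: continuous_normal_pdf; exact: oner_neq0.
apply: DeriveDef; first exact: d1.
by rewrite -derive1E.
Qed.

(** Mills' bound: a Gaussian tail is dominated, up to a constant, by the density at
    its end point [x], because the density recentred at [x] has mass 1. *)
Lemma tail_le (A : set R) (x : R) : measurable A ->
  (forall t, A t -> 0 <= x * (t - x)) ->
  `|\int[leb]_(t in A) (g t * phi t)| <= phi x / peak.
Proof.
move=> mA Ax.
have px : 0 <= phi x / peak.
  by rewrite divr_ge0// ltW// ?phi_gt0// peak_gt0.
have iN : leb.-integrable setT (EFin \o (fun t => phi x / peak * normal_pdf x 1 t)).
  exact: (integrableZl measurableT _ (integrable_normal_pdf x 1)).
apply: (le_trans (le_normr_Rintegral _ _)) => //; first exact: ig.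
apply: le_trans (_ : \int[leb]_(t in A) (phi x / peak * normal_pdf x 1 t) <= _).
  apply: le_Rintegral => //.
  - by have := integrable_norm (ig mA).
  - exact: integrableS iN.
  - move=> t /Ax xt; rewrite normrM (ger0_norm (ltW (phi_gt0 t))).
    apply: le_trans (phi_shift xt).
    by rewrite ler_piMl ?centred_bound// ltW// phi_gt0.
apply: le_trans (_ : \int[leb]_t (phi x / peak * normal_pdf x 1 t) <= _); last first.
  rewrite RintegralZl//; last exact: integrable_normal_pdf.
  by rewrite /Rintegral integral_normal_pdf mulr1.
rewrite /Rintegral fine_le//.
- by apply: integrable_fin_num => //; exact: integrableS iN.
- by apply: integrable_fin_num => //.
- apply: ge0_subset_integral => //.
    by case/integrableP: iN.
  by move=> t _; rewrite lee_fin mulr_ge0// normal_pdf_ge0.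
Qed.

(** To the right of 0 the complementary tail is used, [g] having Gaussian mean 0. *)
Lemma primitive_le (x : R) : `|primitive x| <= phi x / peak.
Proof.
have [x0|x0] := leP x 0.
  apply: tail_le => // t /=; rewrite in_itv/= => tx.
  by rewrite mulr_le0// subr_le0.
have : primitive x = - \int[leb]_(t in [set` `]x, +oo[]) (g t * phi t).
  have := @Rintegral_itvB R (fun t => g t * phi t) -oo%O +oo%O x.
  rewrite set_itvNyy => /(_ (ig measurableT) isT isT).
  by rewrite centred_total sub0r => /esym ->; rewrite opprK.
move=> ->; rewrite normrN; apply: tail_le => // t /=.
by rewrite in_itv/= andbT => xt; rewrite mulr_ge0 ?subr_ge0// ltW.
Qed.

Definition stein_sol (x : R) : R := primitive x * (phi x)^-1.

Lemma stein_sol_le x : `|stein_sol x| <= peak^-1.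
Proof.
have p := phi_gt0 x.
rewrite normrM (@ger0_norm _ (phi x)^-1) ?invr_ge0 ?(ltW p)// ler_pdivrMr//.
by rewrite mulrC; exact: primitive_le.
Qed.

Lemma stein_sol_deriv (x : R) : is_derive x 1 stein_sol (g x + x * stein_sol x).
Proof.
have p : phi x != 0 by rewrite gt_eqF// phi_gt0.
apply: is_derive_eq (derivM (primitive_deriv x) (derivV p (phi_deriv x))) _.
by rewrite /stein_sol; field.
Qed.

Variable e : R.
Hypothesis e01 : 0 < e <= 1.

Let e0 : 0 < e. Proof. by case/andP: e01. Qed.
Let e1 : e <= 1. Proof. by case/andP: e01. Qed.

Definition cutoff (x : R) : R := (1 + e * (x * x))^-1.
Definition cutoff' (x : R) : R := - (2 * e * x) * cutoff x ^+ 2.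

Let den_gt0 x : 0 < 1 + e * (x * x).
Proof. by rewrite ltr_pwDl// mulr_ge0 ?(ltW e0)// -expr2 sqr_ge0. Qed.

Let cutoff_gt0 x : 0 < cutoff x. Proof. by rewrite invr_gt0. Qed.

Let cutoff_eq x : cutoff x = 1 - e * (x * x) * cutoff x.
Proof. by rewrite /cutoff; field; rewrite gt_eqF. Qed.

Let xx0 (x : R) : 0 <= x * x. Proof. by rewrite -expr2 sqr_ge0. Qed.

Let cutoff_le1 x : cutoff x <= 1.
Proof.
rewrite cutoff_eq lerBlDr lerDl mulr_ge0//; last exact: ltW.
by rewrite mulr_ge0// ltW.
Qed.

Let exx_le1 x : e * (x * x) * cutoff x <= 1.
Proof. by have := cutoff_eq x; have := cutoff_gt0 x; lra. Qed.

Let xx_le x : x * x * cutoff x <= e^-1.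
Proof. by rewrite -(ler_pM2l e0) divff ?gt_eqF// mulrA exx_le1. Qed.

Let ei1 : 1 <= e^-1. Proof. by rewrite invf_ge1. Qed.

Let absx_le x : `|x| * cutoff x <= e^-1.
Proof.
have ax0 := normr_ge0 x; have c0 := cutoff_gt0 x.
have xx : `|x| * `|x| = x * x by rewrite -normrM ger0_norm.
have := xx_le x; have := cutoff_le1 x; rewrite -xx => h1 h2.
have [x1|x1] := leP `|x| 1.
  apply: le_trans ei1; apply: le_trans h1; by rewrite ler_piMl// ltW.
apply: le_trans h2; rewrite ler_wpM2r ?(ltW c0)//.
by rewrite ler_peMl// ltW.
Qed.

Lemma cutoff_deriv (x : R) : is_derive x 1 cutoff (cutoff' x).
Proof.
have d (k : R) : is_derive x (1 : R) (fun y : R => 1 + k * (y * y)) (2 * k * x).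
  apply: is_derive_eq (derivD (is_derive_cst _ _ _)
    (derivM (is_derive_cst _ _ _) (derivM (is_derive_id _ _) (is_derive_id _ _)))) _.
  by rewrite /cst; ring.
have dn : 1 + e * (x * x) != 0 by rewrite gt_eqF.
have := @derivV R (fun y => 1 + e * (y * y)) x _ dn (d e).
by move=> h2; apply: is_derive_eq h2 _; rewrite /cutoff' /cutoff; field.
Qed.

(** The factor of [stein_sol] in the derivative of [stein_sol * cutoff], apart
    from the term [g * cutoff]. *)
Definition drift (x : R) : R := x * cutoff x + cutoff' x.
Definition drift' (x : R) : R :=
  cutoff x - 2 * e * (x * x) * cutoff x ^+ 2 - 2 * e * cutoff x ^+ 2 +
  8 * e ^+ 2 * (x * x) * cutoff x ^+ 3.

Lemma drift_deriv (x : R) : is_derive x 1 drift (drift' x).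
Proof.
have d (k : R) : is_derive x (1 : R) (fun y : R => - (2 * k * y)) (- (2 * k)).
  rewrite (_ : (fun y : R => _) = (fun y => (- (2 * k)) * y)); last first.
    by apply/funext => y; ring.
  apply: is_derive_eq (derivM (is_derive_cst _ _ _) (is_derive_id _ _)) _.
  by rewrite mul0r add0r mulr1.
have d2 : is_derive x (1 : R) (fun y => cutoff y ^+ 2) (2 * cutoff x * cutoff' x).
  rewrite (_ : (fun y : R => _) = (fun y => cutoff y * cutoff y)); last first.
    by apply/funext => y; rewrite expr2.
  by apply: is_derive_eq (derivM (cutoff_deriv x) (cutoff_deriv x)) _; ring.
apply: is_derive_eq (derivD (derivM (is_derive_id _ _) (cutoff_deriv x))
  (derivM (d e) d2)) _.
by rewrite /drift' /cutoff'; ring.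
Qed.

Let drift'_le x : `|drift' x| <= 13.
Proof.
have c0 := ltW (cutoff_gt0 x); have c1 := cutoff_le1 x; have y1 := exx_le1 x.
have y0 : 0 <= e * (x * x) * cutoff x.
  by apply: mulr_ge0 => //; apply: mulr_ge0 => //; exact: ltW.
have -> : drift' x = cutoff x - 2 * (e * (x * x) * cutoff x) * cutoff x -
   2 * e * (cutoff x * cutoff x) +
   8 * e * (e * (x * x) * cutoff x) * (cutoff x * cutoff x).
  by rewrite /drift'; ring.
have b01 (a b : R) : 0 <= a -> a <= 1 -> 0 <= b -> b <= 1 -> 0 <= a * b <= 1.
  by move=> a0 a1 b0 b1; rewrite mulr_ge0//= mulr_ile1.
have /andP[p0 p1] := b01 _ _ y0 y1 c0 c1.
have /andP[q0 q1] := b01 _ _ c0 c1 c0 c1.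
have /andP[r0 r1] := b01 _ _ (ltW e0) e1 q0 q1.
have /andP[s0 s1] := b01 _ _ (ltW e0) e1 y0 y1.
have /andP[t0 t1] := b01 _ _ s0 s1 q0 q1.
have -> : 8 * e * (e * (x * x) * cutoff x) * (cutoff x * cutoff x) =
  8 * (e * (e * (x * x) * cutoff x) * (cutoff x * cutoff x)) by ring.
rewrite ler_norml; apply/andP; split; lra.
Qed.

Let cutoff'_le x : `|cutoff' x| <= 2 * e * `|x| * cutoff x.
Proof.
have c0 := ltW (cutoff_gt0 x); have c1 := cutoff_le1 x.
rewrite /cutoff' normrM normrN !normrM normr_nat (ger0_norm (ltW e0)).
rewrite (ger0_norm c0) ler_wpM2l ?ler_piMr//.
by rewrite !mulr_ge0// ltW.
Qed.

Let drift_le x : `|drift x| <= 3 * `|x| * cutoff x.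
Proof.
have c0 := ltW (cutoff_gt0 x).
apply: le_trans (ler_normD _ _) _; rewrite normrM (ger0_norm c0).
have xc : 0 <= `|x| * cutoff x by rewrite mulr_ge0.
have := cutoff'_le x; have := ler_wpM2r xc e1; lra.
Qed.

Let cutoff_lip x y : `|cutoff x - cutoff y| <= 2 * `|x - y|.
Proof.
apply: (deriv_bounded_lipschitz cutoff_deriv) => z.
apply: le_trans (cutoff'_le z) _.
have := absx_le z; rewrite -(ler_pM2l e0) divff ?gt_eqF//; lra.
Qed.

Let K0 : 0 <= K.
Proof. by have := hlip 1 0; rewrite subr0 normr1 mulr1; exact: le_trans. Qed.

(** Multiplying the Stein solution by a cutoff keeps the Stein equation up to
    an error of order [e * (1 + x ^+ 2)], which is small in mean under a unit
    variance, and in exchange makes the derivative globally Lipschitz without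
    sharp Gaussian tail estimates. *)
Lemma stein_approx : exists F F' : R -> R, exists c L : R,
  [/\ 0 <= L, stein_test F F' c L &
   forall x, `|F' x - x * F x - (h x - gauss_mean h)| <=
     e * (1 + peak^-1) * (1 + x ^+ 2)].
Proof.
pose f := stein_sol; pose B := peak^-1.
have B0 : 0 <= B by rewrite invr_ge0 ltW// peak_gt0.
pose F x := f x * cutoff x.
pose F' x := g x * cutoff x + f x * drift x.
pose c := 1 + 3 * B * e^-1.
pose L := K + 2 + (3 * e^-1 + 3 * B * e^-1 + 13 * B).
have ei0 : 0 <= e^-1 by exact: le_trans ei1.
have Fd (x : R) : is_derive x 1 F (F' x).
  apply: is_derive_eq (derivM (stein_sol_deriv x) (cutoff_deriv x)) _.
  by rewrite /F' /drift /f; ring.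
have Fle x : `|f x| <= B by exact: stein_sol_le.
have fdrift x y : `|f x * drift x - f y * drift y| <=
    (3 * e^-1 + 3 * B * e^-1 + 13 * B) * `|x - y|.
  apply: (deriv_bounded_lipschitz (f := fun y => f y * drift y)).
    by move=> z; exact: derivM (stein_sol_deriv z) (drift_deriv z).
  move=> z; have cz := ltW (cutoff_gt0 z).
  have dz := drift_le z; have xz := absx_le z; have d'z := drift'_le z.
  have fz := Fle z; have gz := centred_bound z.
  have h1 : `|g z * drift z| <= 3 * e^-1.
    rewrite normrM; apply: le_trans (_ : 1 * (3 * (`|z| * cutoff z)) <= _).
      by apply: ler_pM => //; lra.
    lra.
  have h2 : `|z * f z * drift z| <= 3 * B * e^-1.
    rewrite 2!normrM; apply: le_trans (_ : `|z| * B * (3 * (`|z| * cutoff z)) <= _).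
      apply: ler_pM; [by rewrite mulr_ge0|by []|by rewrite ler_wpM2l|lra].
    have -> : `|z| * B * (3 * (`|z| * cutoff z)) = 3 * B * (z * z * cutoff z).
      have <- : `|z| * `|z| = z * z by rewrite -normrM ger0_norm.
      by ring.
    by rewrite ler_wpM2l ?mulr_ge0.
  have h3 : `|f z * drift' z| <= 13 * B.
    by rewrite normrM mulrC; apply: ler_pM.
  rewrite mulrDl.
  apply: le_trans (ler_normD _ _) _.
  apply: le_trans (lerD (ler_normD _ _) (lexx _)) _.
  lra.
have gcut x y : `|g x * cutoff x - g y * cutoff y| <= (K + 2) * `|x - y|.
  have -> : g x * cutoff x - g y * cutoff y =
    (g x - g y) * cutoff x + g y * (cutoff x - cutoff y) by ring.
  have h1 : `|(g x - g y) * cutoff x| <= K * `|x - y|.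
    rewrite normrM (ger0_norm (ltW (cutoff_gt0 x))).
    rewrite (_ : g x - g y = h x - h y); last by rewrite /g; ring.
    apply: le_trans (hlip x y); rewrite ler_piMr//.
  have h2 : `|g y * (cutoff x - cutoff y)| <= 2 * `|x - y|.
    rewrite normrM; apply: le_trans (cutoff_lip x y).
    by rewrite ler_piMl// centred_bound.
  apply: le_trans (ler_normD _ _) _; lra.
have F'lip x y : `|F' x - F' y| <= L * `|x - y|.
  have -> : F' x - F' y = (g x * cutoff x - g y * cutoff y) +
      (f x * drift x - f y * drift y) by rewrite /F'; ring.
  apply: le_trans (ler_normD _ _) _; rewrite /L.
  have := gcut x y; have := fdrift x y; lra.
exists F, F', c, L; split.
- rewrite /L !addr_ge0 ?mulr_ge0//.
- split.
  + exact: continuous_measurable_fun (deriv_continuous Fd).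
  + exact: continuous_measurable_fun (lipschitz_continuous F'lip).
  + move=> x; rewrite /F normrM (ger0_norm (ltW (cutoff_gt0 x))) /c.
    apply: le_trans (_ : B * 1 <= _); first by apply: ler_pM => //; exact: ltW.
    have := ler_wpM2l B0 ei1; lra.
  + move=> x; rewrite /F' /c.
    apply: le_trans (ler_normD _ _) _; rewrite (normrM (g x)) (normrM (f x)).
    rewrite (ger0_norm (ltW (cutoff_gt0 x))).
    have h1 : `|g x| * cutoff x <= 1.
      by rewrite mulr_ile1 ?centred_bound// ltW.
    have h2 : `|f x| * `|drift x| <= B * (3 * e^-1).
      apply: ler_pM => //; have := drift_le x; have := absx_le x; lra.
    lra.
  + exact: F'lip.
  + exact: lipschitz_taylor Fd F'lip.
- move=> x.
  have -> : F' x - x * F x - (h x - gauss_mean h) =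
     - (g x * (e * (x * x) * cutoff x)) + f x * cutoff' x.
    rewrite -/(g x) /F' /F /drift.
    rewrite [in g x * cutoff x]cutoff_eq; ring.
  have c0 := cutoff_gt0 x; have c1 := cutoff_le1 x.
  have y0 : 0 <= e * (x * x) by rewrite mulr_ge0// ltW.
  apply: le_trans (ler_normD _ _) _; rewrite normrN (normrM (g x)) (normrM (f x)).
  have h1 : `|g x| * `|e * (x * x) * cutoff x| <= e * x ^+ 2.
    rewrite (@ger0_norm _ (e * (x * x) * cutoff x)); last first.
      by apply: mulr_ge0; rewrite ?(ltW c0).
    rewrite expr2 -[leRHS]mul1r; apply: ler_pM => //.
    - by apply: mulr_ge0; rewrite ?(ltW c0).
    - exact: centred_bound.
    - by rewrite ler_piMr.
  have h2 : `|f x| * `|cutoff' x| <= B * (e * (1 + x ^+ 2)).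
    apply: ler_pM => //; apply: le_trans (cutoff'_le x) _.
    apply: le_trans (_ : 2 * e * `|x| * 1 <= _).
      by rewrite ler_wpM2l// !mulr_ge0// ltW.
    rewrite mulr1 [2 * e]mulrC -mulrA ler_wpM2l ?(ltW e0)//.
    rewrite -(@real_normK _ x) ?num_real//.
    have := sqr_ge0 (`|x| - 1); rewrite sqrrB1 mulr2n; lra.
  rewrite -/B; have := ltW e0; nra.
Qed.

End stein_equation.

(** * Normal approximation of distribution functions *)

Record sample_array d (T : measurableType d) (R : realType)
    (P : probability T R) (I : finType) (m : nat)
    (Z : I -> {RV P >-> m.-tuple R}) (Delta : R) : Prop := SampleArray {
  array_indep : mutually_independent Z;
  array_std : forall k, centered_standardized (Z k);
  array_fourth : forall k s,
    'E_P[(fun w => tnth (Z k w) s ^+ 4)%R]%E = (3 + Delta)%:E;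
  array_factor : forall k, mixed_moments_factor 8 (Z k)
}.

(** The properties of the kernel of a quadratic statistic of variance 1 that make
    it nearly Gaussian: no sample contributes much to the variance, and the
    spectrum is spread out, which the Frobenius norm of the square measures. *)
Record small_kernel (R : realType) (I : finType) (m : nat)
    (A : I * 'I_m -> I * 'I_m -> R) (rho : R) : Prop := SmallKernel {
  small_kernel_sym : forall a b, A a b = A b a;
  small_kernel_diag : forall a b, a.1 = b.1 -> A a b = 0;
  small_kernel_norm : \sum_a \sum_b A a b ^+ 2 = 2;
  small_kernel_infl : forall k, influence A k <= rho;
  small_kernel_sqr : \sum_a \sum_b sq_kernel A a b ^+ 2 <= rho
}.

Section quadratic_clt.
Context (R : realType) (Delta : R).
Local Notation peak := (@normal_peak R 1).

Lemma quad_stat_lipschitz_clt (h : R -> R) (K e : R) :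
  (forall x, 0 <= h x <= 1) -> (forall x y, `|h x - h y| <= K * `|x - y|) ->
  0 < e -> exists2 rho : R, 0 < rho &
  forall d (T : measurableType d) (P : probability T R) (I : finType) (m : nat)
    (Z : I -> {RV P >-> m.-tuple R}) (A : I * 'I_m -> I * 'I_m -> R),
    sample_array Z Delta -> small_kernel A rho ->
    `|rexp P (fun w => h (quad_stat Z A w)) - gauss_mean h| <= e.
Proof.
move=> h01 hlip e0; set B := peak^-1.
have B0 : 0 <= B by rewrite invr_ge0 ltW// peak_gt0.
(* [E (1 + T^2) = 2], so this choice keeps the error of [stein_approx] below
   [e / 2]; [del] and [rho] split the other half between the two parts of
   [stein_bound]. *)
pose e1 := Num.min 1 (e / (4 * (1 + B))).
have B1 : 0 < 4 * (1 + B) by rewrite mulr_gt0// ltr_pwDl.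
have e1P : 0 < e1 <= 1.
  by rewrite lt_min ltr01 divr_gt0//= ge_min lexx.
have e1e : e1 * (4 * (1 + B)) <= e by rewrite -ler_pdivlMr// ge_min lexx orbT.
have [F [F' [c [L [L0 FF' happ]]]]] := stein_approx h01 hlip e1P.
have c0 : 0 <= c by exact: le_trans (stein_bnd FF' 0).
pose C := 3 + `|Delta|.
pose D := (C ^+ 2 + C) / 2; pose D' := (2 + `|Delta|) / 8.
have C0 : 0 <= C by rewrite addr_ge0.
have D0 : 0 <= D by rewrite divr_ge0// addr_ge0// sqr_ge0.
have D'0 : 0 <= D' by rewrite divr_ge0// addr_ge0.
pose M1 := L + c / 2 + 1; pose M2 := L * D + c * D' + 1.
have M10 : 0 < M1 by rewrite ltr_wpDl// addr_ge0// divr_ge0.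
have M20 : 0 < M2 by rewrite ltr_wpDl// addr_ge0// mulr_ge0.
pose del := e / (4 * M1).
have del0 : 0 < del by rewrite divr_gt0// mulr_gt0.
pose rho := del * (e / (4 * M2)).
have r0 : 0 < rho by rewrite mulr_gt0// divr_gt0// mulr_gt0.
exists rho => // d T P I m Z A [iZ sZ fZ mZ] [sA dA nA vA wA].
have SB := stein_bound iZ sZ fZ mZ sA dA nA FF' L0 del0 vA wA.
have mT : measurable_fun setT (quad_stat Z A) by exact: quad_stat_meas.
have iT2 := quad_stat_int2 iZ sZ fZ mZ A.
have T2 : rexp P (fun w => quad_stat Z A w ^+ 2) = 1.
  by rewrite (quad_stat_exp2 iZ sZ fZ mZ sA dA) nA mulVf.
have i1 : rint P (fun w => 1 + quad_stat Z A w ^+ 2).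
  by apply: rintD => //; exact: rint_cst.
have mh : measurable_fun setT (fun w => h (quad_stat Z A w)).
  apply: measurableT_comp mT.
  exact: continuous_measurable_fun (lipschitz_continuous hlip).
have mF : measurable_fun setT (fun w => F (quad_stat Z A w)).
  by apply: measurableT_comp mT; exact: stein_meas FF'.
have mF' : measurable_fun setT (fun w => F' (quad_stat Z A w)).
  by apply: measurableT_comp mT; exact: stein_meas' FF'.
have ih : rint P (fun w => h (quad_stat Z A w)).
  apply: (@rint_bounded _ _ _ P _ 1 mh) => w.
  by have /andP[h0 h1] := h01 (quad_stat Z A w); rewrite ger0_norm.
have iF' : rint P (fun w => F' (quad_stat Z A w)).
  by apply: (@rint_bounded _ _ _ P _ c mF') => w; exact: stein_bnd' FF' _.
have iTF : rint P (fun w => quad_stat Z A w * F (quad_stat Z A w)).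
  apply: (rint_le (Y := fun w => c * (1 + quad_stat Z A w ^+ 2))).
  - exact: measurable_funM.
  - move=> w; rewrite normrM mulrC ler_pM// ?(stein_bnd FF')//.
    rewrite -(@real_normK _ (quad_stat Z A w)) ?num_real//.
    have := sqr_ge0 (`|quad_stat Z A w| - 2^-1); rewrite sqrrB; lra.
  - exact: rintZ.
set EE := rexp P (fun w =>
  F' (quad_stat Z A w) - quad_stat Z A w * F (quad_stat Z A w)) in SB.
have iE : rint P (fun w =>
    F' (quad_stat Z A w) - quad_stat Z A w * F (quad_stat Z A w)).
  exact: rintB.
have ihc : rint P (fun w => h (quad_stat Z A w) - gauss_mean h).
  by apply: rintB => //; exact: rint_cst.
have b1 : `|EE - (rexp P (fun w => h (quad_stat Z A w)) - gauss_mean h)| <= e / 2.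
  rewrite -[gauss_mean h in X in `|X|](rexp_cst P) -rexpB//; last exact: rint_cst.
  rewrite /EE -rexpB//.
  apply: le_trans (rexp_norm_le (Y := fun w => e1 * (1 + B) * (1 + quad_stat Z A w ^+ 2))
    _ _ _) _.
  - by apply: measurable_funB; apply: measurable_funB => //; exact: measurable_funM.
  - exact: rintZ.
  - by move=> w; exact: happ.
  - rewrite rexpZ// rexpD//; last exact: rint_cst.
    by rewrite rexp_cst T2; lra.
have b2 : `|EE| <= e / 2.
  apply: le_trans SB _; rewrite -/C -/D -/D'.
  have -> : L * (del + D / del * rho) + c * (del / 2 + D' / del * rho) =
    del * (M1 - 1) + e / (4 * M2) * (M2 - 1).
    by rewrite /rho /M1 /M2; field; rewrite ?gt_eqF.
  have h1 : del * M1 = e / 4 by rewrite /del; field; rewrite gt_eqF.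
  have h2 : e / (4 * M2) * M2 = e / 4 by field; rewrite gt_eqF.
  have h3 : 0 < e / (4 * M2) by rewrite divr_gt0// mulr_gt0.
  rewrite !mulrBr h1 h2; lra.
have -> : rexp P (fun w => h (quad_stat Z A w)) - gauss_mean h =
  EE - (EE - (rexp P (fun w => h (quad_stat Z A w)) - gauss_mean h)) by ring.
apply: le_trans (ler_normB _ _) _; lra.
Qed.

Definition ramp (x eta t : R) : R := Num.max 0 (Num.min 1 ((x + eta - t) / eta)).

Section ramp.
Variables (x eta : R).
Hypothesis eta0 : 0 < eta.

Lemma ramp01 t : 0 <= ramp x eta t <= 1.
Proof. by rewrite /ramp le_max lexx/= ge_max ler01/= ge_min lexx. Qed.

Lemma ramp_left t : t <= x -> ramp x eta t = 1.
Proof.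
move=> tx; rewrite /ramp min_l ?max_r// ler_pdivlMr//; lra.
Qed.

Lemma ramp_right t : x + eta < t -> ramp x eta t = 0.
Proof.
move=> tx; rewrite /ramp max_l// ge_min; apply/orP; right.
by rewrite ler_pdivrMr// mul0r; lra.
Qed.

Lemma ramp_lipschitz s t : `|ramp x eta s - ramp x eta t| <= eta^-1 * `|s - t|.
Proof.
have clip (y z : R) : `|Num.max 0 (Num.min 1 y) - Num.max 0 (Num.min 1 z)| <= `|y - z|.
  have n1 := ler_norm (y - z); have n2 := ler_norm (z - y).
  rewrite distrC in n2; rewrite ler_norml; move: n1 n2; set n := `|y - z| => n1 n2.
  apply/andP; split; rewrite /Num.max /Num.min;
    case: (ltP 1 y) => ?; case: (ltP 1 z) => ?; do !case: ltP => ?; lra.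
apply: le_trans (clip _ _) _.
rewrite (_ : _ - _ = eta^-1 * (t - s)); last by ring.
by rewrite normrM distrC (ger0_norm (ltW _)) ?invr_gt0.
Qed.

End ramp.

Local Notation Phi y := (fine (normal_prob (0 : R) 1 `]-oo, y]%classic)).

Lemma PhiE y :
  Phi y = \int[@lebesgue_measure R]_(t in `]-oo, y]%classic) normal_pdf 0 1 t.
Proof. by []. Qed.

Lemma fine_prob_indic d (T : measurableType d) (P : probability T R) (A : set T) :
  measurable A -> fine (P A) = rexp P (\1_A).
Proof. by move=> mA; rewrite /rexp /Rintegral integral_indic// setIT. Qed.

Lemma Phi_gauss_mean y : Phi y = gauss_mean (\1_(`]-oo, y]%classic : set R)).
Proof.
rewrite PhiE Rintegral_mkcond; apply: eq_Rintegral => t _.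
by rewrite patchE indicE; case: ifP => _; rewrite ?mul1r ?mul0r.
Qed.

Lemma gauss_mean_le (u v : R -> R) :
  measurable_fun setT u -> measurable_fun setT v ->
  (forall t, 0 <= u t <= 1) -> (forall t, 0 <= v t <= 1) ->
  (forall t, u t <= v t) -> gauss_mean u <= gauss_mean v.
Proof.
move=> mu mv u01 v01 uv; apply: le_Rintegral => //.
- apply: (bounded_phi_int (c := 1)) => // t.
  by have /andP[? ?] := u01 t; rewrite ger0_norm.
- apply: (bounded_phi_int (c := 1)) => // t.
  by have /andP[? ?] := v01 t; rewrite ger0_norm.
- by move=> t _; rewrite ler_wpM2r ?(ltW (phi_gt0 t)).
Qed.

Lemma indic01 (A : set R) (t : R) : 0 <= (\1_A t : R) <= 1.
Proof. by rewrite indicE; case: (_ \in _); rewrite lexx ler01. Qed.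

Lemma ramp_meas x eta : 0 < eta -> measurable_fun setT (ramp x eta).
Proof.
move=> eta0; apply: continuous_measurable_fun.
exact: lipschitz_continuous (ramp_lipschitz x eta0).
Qed.

Lemma gauss_mean_ramp_le x eta : 0 < eta ->
  gauss_mean (ramp x eta) <= Phi (x + eta).
Proof.
move=> eta0; rewrite Phi_gauss_mean; apply: gauss_mean_le.
- exact: ramp_meas.
- exact: measurable_indic.
- exact: ramp01.
- exact: indic01.
- move=> t; rewrite indicE.
  have [_|] := boolP (t \in _); first by have /andP[] := ramp01 x eta t.
  move/negP => tN; rewrite ramp_right// ltNge; apply/negP => tx.
  by apply: tN; rewrite inE/= in_itv.
Qed.

Lemma gauss_mean_ramp_ge x eta : 0 < eta -> Phi x <= gauss_mean (ramp x eta).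
Proof.
move=> eta0; rewrite Phi_gauss_mean; apply: gauss_mean_le.
- exact: measurable_indic.
- exact: ramp_meas.
- exact: indic01.
- exact: ramp01.
- move=> t; rewrite indicE.
  have [|_] := boolP (t \in _); last by have /andP[] := ramp01 x eta t.
  by rewrite inE/= in_itv/= => tx; rewrite ramp_left.
Qed.

(** The indicator of [t <= x] lies above the ramp that ends at [x] and below the
    ramp that starts at [x]. *)
Lemma quad_stat_cdf (x eta e : R) : 0 < eta -> 0 < e ->
  exists2 rho : R, 0 < rho &
  forall d (T : measurableType d) (P : probability T R) (I : finType) (m : nat)
    (Z : I -> {RV P >-> m.-tuple R}) (A : I * 'I_m -> I * 'I_m -> R),
    sample_array Z Delta -> small_kernel A rho ->
    Phi (x - eta) - e <= fine (P (quad_stat Z A @^-1` `]-oo, x]%classic)) /\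
    fine (P (quad_stat Z A @^-1` `]-oo, x]%classic)) <= Phi (x + eta) + e.
Proof.
move=> eta0 e0.
have [r1 r10 H1] := quad_stat_lipschitz_clt (ramp01 (x - eta) eta)
  (ramp_lipschitz (x - eta) eta0) e0.
have [r2 r20 H2] := quad_stat_lipschitz_clt (ramp01 x eta) (ramp_lipschitz x eta0) e0.
exists (Num.min r1 r2) => [|d T P I m Z A sA kA]; first by rewrite lt_min r10.
have k1 : small_kernel A r1.
  case: kA => a1 a2 a3 a4 a5; split => // [k|].
    by apply: le_trans (a4 k) _; rewrite ge_min lexx.
  by apply: le_trans a5 _; rewrite ge_min lexx.
have k2 : small_kernel A r2.
  case: kA => a1 a2 a3 a4 a5; split => // [k|].
    by apply: le_trans (a4 k) _; rewrite ge_min lexx orbT.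
  by apply: le_trans a5 _; rewrite ge_min lexx orbT.
have {}H1 := H1 _ _ _ _ _ _ _ sA k1; have {}H2 := H2 _ _ _ _ _ _ _ sA k2.
have mT : measurable_fun setT (quad_stat Z A) by exact: quad_stat_meas.
have mE : measurable (quad_stat Z A @^-1` `]-oo, x]%classic).
  by rewrite -[X in measurable X]setTI; exact: mT.
have ih y : rint P (fun w => ramp y eta (quad_stat Z A w)).
  apply: (@rint_bounded _ _ _ P _ 1).
    apply: measurableT_comp mT; apply: continuous_measurable_fun.
    exact: lipschitz_continuous (ramp_lipschitz y eta0).
  by move=> w; have /andP[h0 h1] := ramp01 y eta (quad_stat Z A w); rewrite ger0_norm.
have iI : rint P (\1_(quad_stat Z A @^-1` `]-oo, x]%classic)).
  exact: integrable_indic.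
have up := gauss_mean_ramp_le x eta0.
have lo := gauss_mean_ramp_ge (x - eta) eta0.
rewrite fine_prob_indic//; split.
- have : rexp P (fun w => ramp (x - eta) eta (quad_stat Z A w)) <=
      rexp P (\1_(quad_stat Z A @^-1` `]-oo, x]%classic)).
    apply: rexp_le => // w; rewrite indicE.
    have [_|] := boolP (w \in _).
      by have /andP[] := ramp01 (x - eta) eta (quad_stat Z A w).
    move/negP => wN; rewrite ramp_right// subrK ltNge; apply/negP => wx.
    by apply: wN; rewrite inE/= in_itv.
  by move: H1; rewrite ler_norml => /andP[h1 h2]; lra.
- have : rexp P (\1_(quad_stat Z A @^-1` `]-oo, x]%classic)) <=
      rexp P (fun w => ramp x eta (quad_stat Z A w)).
    apply: rexp_le => // w; rewrite indicE.
    have [|_] := boolP (w \in _); last first.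
      by have /andP[] := ramp01 x eta (quad_stat Z A w).
    by rewrite inE/= in_itv/= => wx; rewrite ramp_left.
  by move: H2; rewrite ler_norml => /andP[h1 h2]; lra.
Qed.

End quadratic_clt.

(** * Kernels that depend only on the populations *)

Lemma le_of_sqr (R : realDomainType) (y z : R) : 0 <= z -> y ^+ 2 <= z ^+ 2 -> y <= z.
Proof. by move=> z0 yz; rewrite leNgt; apply/negP => zy; nra. Qed.

Lemma minkowski_sum (R : realDomainType) (X I : finType) (f : I -> X -> R)
    (r : I -> R) : (forall i, 0 <= r i) ->
  (forall i, \sum_x f i x ^+ 2 <= r i ^+ 2) ->
  \sum_x (\sum_i f i x) ^+ 2 <= (\sum_i r i) ^+ 2.
Proof.
move=> r0 fr; under eq_bigr do rewrite expr2 big_distrlr/=.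
rewrite exchange_big/= expr2 big_distrlr/=; apply: ler_sum => i _.
rewrite exchange_big/=; apply: ler_sum => j _.
apply: le_of_sqr; first by rewrite mulr_ge0.
apply: le_trans (cauchy_schwarz_sum _ _) _.
by rewrite exprMn ler_pM// sumr_ge0// => x _; exact: sqr_ge0.
Qed.

Section typed_kernel.
Context (R : realType) (I KT : finType) (m : nat) (ty : I -> KT).
Context (c : KT -> KT -> R) (G : KT -> KT -> 'M[R]_m).
Hypothesis symc : forall al be, c al be = c be al.
Hypothesis symG : forall al be, G be al = (G al be)^T.

Definition typed_kernel (a b : I * 'I_m) : R :=
  if a.1 == b.1 then 0 else c (ty a.1) (ty b.1) * G (ty a.1) (ty b.1) a.2 b.2.

Local Notation A := typed_kernel.

Definition frob (M : 'M[R]_m) : R := \sum_s \sum_t M s t ^+ 2.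

Lemma frob_ge0 M : 0 <= frob M.
Proof. by apply: sumr_ge0 => s _; apply: sumr_ge0 => t _; exact: sqr_ge0. Qed.

Lemma typed_kernel_sym a b : A a b = A b a.
Proof.
by rewrite /A eq_sym; case: ifP => // _; rewrite symc (symG (ty b.1)) mxE.
Qed.

Lemma typed_kernel_diag a b : a.1 = b.1 -> A a b = 0.
Proof. by rewrite /A => ->; rewrite eqxx. Qed.

(* the squared Frobenius norm of the block [(k, l)] *)
Let w k l : R :=
  if k == l then 0 else c (ty k) (ty l) ^+ 2 * frob (G (ty k) (ty l)).

Let w0 k l : 0 <= w k l.
Proof. by rewrite /w; case: ifP => // _; rewrite mulr_ge0 ?sqr_ge0 ?frob_ge0. Qed.

Let wE k l : w k l = \sum_s \sum_t A (k, s) (l, t) ^+ 2.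
Proof.
rewrite /w /A/=; case: ifP => _.
  by rewrite big1// => s _; rewrite big1// => t _; rewrite expr0n.
rewrite mulr_sumr; apply: eq_bigr => s _; rewrite mulr_sumr.
by apply: eq_bigr => t _; rewrite exprMn.
Qed.

Let inflE k : influence A k = \sum_l w k l.
Proof.
rewrite /influence; under eq_bigr do rewrite sum_prod.
by rewrite exchange_big/=; apply: eq_bigr => l _; rewrite wE.
Qed.

Let infl_type k k' : ty k = ty k' -> influence A k = influence A k'.
Proof.
have E j : influence A j = \sum_l c (ty j) (ty l) ^+ 2 * frob (G (ty j) (ty l))
     - c (ty j) (ty j) ^+ 2 * frob (G (ty j) (ty j)).
  rewrite inflE (bigD1 j)//= {1}/w eqxx add0r [in RHS](bigD1 j)//= addrC addrK.
  by apply: eq_bigr => l /negPf lj; rewrite /w eq_sym lj.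
by move=> kk'; rewrite !E kk'.
Qed.

Hypothesis normA : \sum_a \sum_b A a b ^+ 2 = 2.

Let sum_infl2 : \sum_k influence A k = 2.
Proof. by rewrite -normA sum_prod. Qed.

(** Samples of the same type have equal influences, so that each is at most
    the total influence divided by the number of them. *)
Lemma typed_kernel_infl k : influence A k * #|[pred l | ty l == ty k]|%:R <= 2.
Proof.
rewrite -sum_infl2 (bigID (fun l => ty l == ty k))/=.
rewrite (eq_bigr (fun=> influence A k)); last by move=> l /eqP; exact: infl_type.
rewrite sumr_const mulr_natr lerDl sumr_ge0// => l _.
exact: influence_ge0.
Qed.

(** Block by block, the square of the kernel is a sum over the intermediate
    samples [r] of multiples of [G al be *m G be ga]; by Minkowski's inequality
    the norm of the block [(k, l)] is at most the sum over [r] of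
    [sqrt (e * w k r * w r l)], and Cauchy-Schwarz bounds that sum by
    [sqrt (e * influence k * influence l)]. *)
Lemma typed_kernel_sqr e : 0 <= e ->
  (forall al be ga, frob (G al be *m G be ga) <=
     e * (frob (G al be) * frob (G be ga))) ->
  \sum_a \sum_b sq_kernel A a b ^+ 2 <= 4 * e.
Proof.
move=> e0 Ge.
pose f k l r (x : 'I_m * 'I_m) := \sum_t A (k, x.1) (r, t) * A (r, t) (l, x.2).
have step k l : \sum_x (\sum_r f k l r x) ^+ 2 <= e * (influence A k * influence A l).
  pose rr r := Num.sqrt (e * (w k r * w r l)).
  have rr0 r : 0 <= rr r by exact: sqrtr_ge0.
  have rrE r : rr r ^+ 2 = e * (w k r * w r l).
    by rewrite sqr_sqrtr// !mulr_ge0.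
  apply: le_trans (minkowski_sum rr0 _) _.
    move=> r; rewrite rrE /f sum_prod/=.
    have [kr|kr] := eqVneq k r.
      rewrite big1 ?mulr_ge0// => s _; rewrite big1// => u _.
      by rewrite big1 ?expr0n// => t _; rewrite typed_kernel_diag ?mul0r.
    have [rl|rl] := eqVneq r l.
      rewrite big1 ?mulr_ge0// => s _; rewrite big1// => u _.
      by rewrite big1 ?expr0n// => t _; rewrite [X in _ * X]typed_kernel_diag ?mulr0.
    rewrite /w (negPf kr) (negPf rl).
    have -> : \sum_s \sum_u (\sum_t A (k, s) (r, t) * A (r, t) (l, u)) ^+ 2 =
        (c (ty k) (ty r) * c (ty r) (ty l)) ^+ 2 *
        frob (G (ty k) (ty r) *m G (ty r) (ty l)).
      rewrite mulr_sumr; apply: eq_bigr => s _; rewrite mulr_sumr.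
      apply: eq_bigr => u _; rewrite mxE -exprMn; congr (_ ^+ 2).
      rewrite mulr_sumr; apply: eq_bigr => t _.
      by rewrite /A/= (negPf kr) (negPf rl); ring.
    have := ler_wpM2l (sqr_ge0 (c (ty k) (ty r) * c (ty r) (ty l)))
      (Ge (ty k) (ty r) (ty l)).
    by rewrite exprMn; lra.
  have := cauchy_schwarz_sum (fun r => Num.sqrt (w k r)) (fun r => Num.sqrt (w r l)).
  have sE : \sum_r rr r = Num.sqrt e * \sum_r Num.sqrt (w k r) * Num.sqrt (w r l).
    by rewrite mulr_sumr; apply: eq_bigr => r _; rewrite /rr !sqrtrM.
  rewrite sE exprMn sqr_sqrtr// => cs; rewrite ler_wpM2l//.
  apply: le_trans cs _; rewrite !inflE.
  under eq_bigr do rewrite sqr_sqrtr//.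
  under [X in _ * X <= _]eq_bigr do rewrite sqr_sqrtr//.
  rewrite le_eqVlt; apply/orP; left; apply/eqP; congr (_ * _).
  apply: eq_bigr => r _; rewrite /w eq_sym symc symG; case: ifP => // _.
  by congr (_ * _); rewrite /frob exchange_big; apply: eq_bigr => s _;
    apply: eq_bigr => t _; rewrite mxE.
have -> : \sum_a \sum_b sq_kernel A a b ^+ 2 =
    \sum_k \sum_l \sum_x (\sum_r f k l r x) ^+ 2.
  rewrite sum_prod; apply: eq_bigr => k _.
  under eq_bigr do rewrite sum_prod.
  rewrite exchange_big/=; apply: eq_bigr => l _.
  rewrite sum_prod; apply: eq_bigr => s _; apply: eq_bigr => u _.
  by rewrite /sq_kernel sum_prod.
apply: le_trans (_ : \sum_k \sum_l e * (influence A k * influence A l) <= _).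
  by apply: ler_sum => k _; apply: ler_sum => l _; exact: step.
under eq_bigr do rewrite -!mulr_sumr.
rewrite -mulr_sumr -mulr_suml sum_infl2; lra.
Qed.

End typed_kernel.

Section traces.
Context (R : comRingType) (m p : nat).

Lemma mxtrace_frob (M : 'M[R]_m) : \tr (M *m M^T) = \sum_s \sum_t M s t ^+ 2.
Proof.
apply: eq_bigr => s _; rewrite mxE; apply: eq_bigr => t _.
by rewrite mxE expr2.
Qed.

Variables (W : 'M[R]_p) (Ga Gb Gc : 'M[R]_(p, m)).
Hypothesis symW : W^T = W.
Local Notation S M := (M *m M^T).

Lemma frob_bilinear : \sum_s \sum_t (Ga^T *m W *m Gb) s t ^+ 2 =
  \tr (W *m S Ga *m W *m S Gb).
Proof.
rewrite -mxtrace_frob !trmx_mul symW trmxK -!mulmxA mxtrace_mulC.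
have -> : W *m (Ga *m (Ga^T *m (W *m S Gb))) = (W *m S Ga) *m (W *m S Gb).
  by rewrite !mulmxA.
by rewrite [RHS]mxtrace_mulC !mulmxA.
Qed.

Lemma frob_bilinear_mul :
  \sum_s \sum_t ((Ga^T *m W *m Gb) *m (Gb^T *m W *m Gc)) s t ^+ 2 =
  \tr (W *m S Ga *m W *m S Gb *m W *m S Gc *m W *m S Gb).
Proof.
rewrite -mxtrace_frob !trmx_mul symW !trmxK -!mulmxA mxtrace_mulC.
have -> : W *m (Ga *m (Ga^T *m (W *m (Gb *m (Gb^T *m (W *m (Gc *m
    (Gc^T *m (W *m S Gb))))))))) =
    (W *m S Ga) *m (W *m S Gb *m W *m S Gc *m W *m S Gb).
  by rewrite !mulmxA.
by rewrite [RHS]mxtrace_mulC !mulmxA.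
Qed.

End traces.

(** * The statistic as a quadratic form *)

Lemma weight_mx_sym (R : realType) p (a b : 'I_p -> R) :
  (weight_mx a b)^T = weight_mx a b.
Proof. by rewrite /weight_mx linearD/= tr_diag_mx trmx_mul trmxK. Qed.

Lemma bilinear_coord (R : comRingType) m p (W : 'M[R]_p) (Ga Gb : 'M[R]_(p, m))
    (x y : 'I_m -> R) :
  ((Ga *m \col_s x s)^T *m W *m (Gb *m \col_t y t)) 0 0 =
  \sum_s \sum_t (Ga^T *m W *m Gb) s t * (x s * y t).
Proof.
rewrite trmx_mul !mulmxA -[_ *m Ga^T *m W *m Gb]mulmxA -mulmxA -[_ *m Ga^T *m _]mulmxA.
rewrite !mulmxA -[_ *m Ga^T *m W]mulmxA -[_ *m (Ga^T *m W) *m Gb]mulmxA.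
rewrite mxE exchange_big/=; apply: eq_bigr => t _; rewrite !mxE mulr_suml.
by apply: eq_bigr => s _; rewrite !mxE; ring.
Qed.

Section statistic_as_form.
Context (R : realType) (K q : nat) (Gt : 'M[R]_(q, K)) (ns : 'I_K -> nat).

Definition pair_coef (al be : 'I_K) : R :=
  if al == be then d_coef Gt ns al al / ((ns al)%:R * ((ns al)%:R - 1))
  else d_coef Gt ns al be / ((ns al)%:R * (ns be)%:R).

Lemma d_coef_sym al be : d_coef Gt ns al be = d_coef Gt ns be al.
Proof. by rewrite /d_coef !mxE; apply: eq_bigr => i _; rewrite !mxE mulrC. Qed.

Lemma pair_coef_sym al be : pair_coef al be = pair_coef be al.
Proof.
rewrite /pair_coef eq_sym; case: eqP => [->//|_].
by rewrite d_coef_sym [X in _ / X]mulrC.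
Qed.

Local Notation I := {al : 'I_K & 'I_(ns al)}.

(** Together, the two sums of the statistic run over the ordered pairs of distinct
    samples. *)
Lemma Tn0_pairs p (W : 'M[R]_p) (X : forall al, 'I_(ns al) -> 'cV[R]_p) :
  Tn0 Gt W X = \sum_(k : I) \sum_(l : I | l != k)
    pair_coef (tag k) (tag l) * ((X _ (tagged k))^T *m W *m X _ (tagged l)) 0 0.
Proof.
pose tg al (i : 'I_(ns al)) : I := Tagged (fun al => 'I_(ns al)) i.
pose Q (k l : I) : R := ((X _ (tagged k))^T *m W *m X _ (tagged l)) 0 0.
rewrite -(@sig_big_dep _ _ _ 'I_K (fun al => 'I_(ns al)) xpredT (fun _ => xpredT)
  (fun al i => \sum_(l : I | l != tg al i)
    pair_coef al (tag l) * Q (tg al i) l))/=.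
rewrite /Tn0 -big_split/=; apply: eq_bigr => al _.
have inner (i : 'I_(ns al)) : \sum_(l : I | l != tg al i)
    pair_coef al (tag l) * Q (tg al i) l =
    \sum_(j | j != i) d_coef Gt ns al al / ((ns al)%:R * ((ns al)%:R - 1)) *
      Q (tg al i) (tg _ j) +
    \sum_(be | be != al) \sum_(j : 'I_(ns be))
      d_coef Gt ns al be / ((ns al)%:R * (ns be)%:R) * Q (tg al i) (tg _ j).
  rewrite (bigID (fun l : I => tag l == al))/=; congr (_ + _).
    transitivity (\sum_(be | be == al) \sum_(j : 'I_(ns be) |
       tg be j != tg al i)
       pair_coef al be * Q (tg al i) (tg _ j)).
      rewrite sig_big_dep/=; apply: eq_big => [[be j]|[be j] _]//=.
      by rewrite andbC.
    rewrite big_pred1_eq; apply: eq_big => j.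
      by rewrite eq_Tagged.
    by rewrite /pair_coef eqxx.
  transitivity (\sum_(be | be != al) \sum_(j : 'I_(ns be))
       pair_coef al be * Q (tg al i) (tg _ j)).
    rewrite sig_big_dep/=; apply: eq_big => [[be j]|[be j] _]//=.
    rewrite andbT; case: (eqVneq be al) => [//|ba] /=; rewrite ?andbF//.
    rewrite andbT; apply/eqP => E; case/eqP: ba; exact: (congr1 tag E).
  apply: eq_bigr => be ba; apply: eq_bigr => j _.
  by rewrite /pair_coef eq_sym (negPf ba).
under [RHS]eq_bigr do rewrite inner.
rewrite big_split/=; congr (_ + _).
  rewrite mulrA mulrAC mulr_sumr; apply: eq_bigr => i _.
  by rewrite mulr_sumr; apply: eq_bigr => j _.
rewrite exchange_big/=; apply: eq_bigr => be _.
rewrite mulrA mulrAC mulr_sumr; apply: eq_bigr => i _.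
by rewrite mulr_sumr; apply: eq_bigr => j _.
Qed.

Lemma card_samples al : #|[pred l : I | tag l == al]| = ns al.
Proof.
rewrite -sum1_card (eq_bigl (fun l : I => (tag l == al) && true)); last first.
  by move=> l; rewrite !inE andbT.
rewrite -(@sig_big_dep _ _ _ 'I_K (fun al => 'I_(ns al)) (fun be => be == al)
  (fun _ => xpredT) (fun _ _ => 1%N))/=.
by rewrite big_pred1_eq sum1_card card_ord.
Qed.

End statistic_as_form.

Section standardized_statistic.
Context (R : realType) (K q : nat) (Gt : 'M[R]_(q, K)) (ns : 'I_K -> nat).
Context (p m : nat) (W : 'M[R]_p) (Gamma : 'I_K -> 'M[R]_(p, m)).
Context d (T : measurableType d) (P : probability T R).
Context (Z : forall al, 'I_(ns al) -> {RV P >-> m.-tuple R}).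
Hypothesis symW : W^T = W.

Local Notation I := {al : 'I_K & 'I_(ns al)}.

Definition samples (k : I) : {RV P >-> m.-tuple R} := Z (tagged k).

Definition link (al be : 'I_K) : 'M[R]_m := (Gamma al)^T *m W *m Gamma be.

(** The kernel of the statistic divided by [s]; the factor 2 compensates the
    factor [1/2] in [quad_stat]. *)
Definition stat_kernel (s : R) : I * 'I_m -> I * 'I_m -> R :=
  typed_kernel (fun k : I => tag k)
    (fun al be => s^-1 * (2 * pair_coef Gt ns al be)) link.

Lemma link_sym al be : link be al = (link al be)^T.
Proof. by rewrite /link !trmx_mul trmxK symW mulmxA. Qed.

Lemma coef_sym s al be : s^-1 * (2 * pair_coef Gt ns al be) =
  s^-1 * (2 * pair_coef Gt ns be al).
Proof. by rewrite pair_coef_sym. Qed.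

Lemma stat_kernel_sym s a b : stat_kernel s a b = stat_kernel s b a.
Proof. by apply: typed_kernel_sym; [exact: coef_sym|exact: link_sym]. Qed.

Lemma stat_kernel_diag s a b : a.1 = b.1 -> stat_kernel s a b = 0.
Proof. exact: typed_kernel_diag. Qed.

Lemma stat_kernel_scale s a b : stat_kernel s a b = s^-1 * stat_kernel 1 a b.
Proof.
by rewrite /stat_kernel /typed_kernel; case: ifP => _; rewrite ?mulr0// invr1; ring.
Qed.

Lemma stat_Tn0 s w :
  quad_stat samples (stat_kernel s) w =
  Tn0 Gt W (fun al (i : 'I_(ns al)) =>
    Gamma al *m (\col_t tnth (Z i w) t)) / s.
Proof.
rewrite Tn0_pairs /quad_stat /qform sum_prod mulr_sumr mulr_suml.
apply: eq_bigr => k _; under eq_bigr do rewrite sum_prod.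
rewrite exchange_big/= (bigD1 k)//= big1 ?add0r => [|s' _]; last first.
  by rewrite big1// => t _; rewrite stat_kernel_diag ?mul0r.
rewrite mulr_sumr mulr_suml; apply: eq_bigr => l lk.
rewrite bilinear_coord mulr_sumr mulr_sumr mulr_suml; apply: eq_bigr => s' _.
rewrite mulr_sumr mulr_sumr mulr_suml; apply: eq_bigr => t _.
rewrite /stat_kernel /typed_kernel/= eq_sym (negPf lk) /coord /samples /link/=.
by move: (s^-1) => si; field.
Qed.

Context (Delta : R).
Hypothesis sZ : sample_array samples Delta.

Lemma stat_variance s :
  'V_P[quad_stat samples (stat_kernel s)]%E =
  (2^-1 * \sum_a \sum_b stat_kernel s a b ^+ 2)%:E.
Proof.
have [iZ stdZ fZ mZ] := sZ.
have sA := stat_kernel_sym s; have dA := @stat_kernel_diag s.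
have iT2 := quad_stat_int2 iZ stdZ fZ mZ (stat_kernel s).
have mT : measurable_fun setT (quad_stat samples (stat_kernel s)).
  exact: quad_stat_meas.
have iT : rint P (quad_stat samples (stat_kernel s)).
  apply: (rint_le (Y := fun w => 1 + quad_stat samples (stat_kernel s) w ^+ 2)) => //.
    move=> w; rewrite -(@real_normK _ (quad_stat _ _ w)) ?num_real//.
    have := sqr_ge0 (`|quad_stat samples (stat_kernel s) w| - 2^-1).
    by rewrite sqrrB; lra.
  by apply: rintD => //; exact: rint_cst.
have E0 : 'E_P[quad_stat samples (stat_kernel s)]%E = 0%E.
  by rewrite rexpE// (quad_stat_exp iZ stdZ fZ mZ dA).
rewrite /variance unlock E0/=.
rewrite -(quad_stat_exp2 iZ stdZ fZ mZ sA dA) -rexpE//.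
congr expectation; apply/funext => w.
by rewrite expr2 -[X in _ = X * _]subr0 -[X in _ = _ * X]subr0.
Qed.

(** Large samples bound the influences and small traces bound the square of the
    kernel. *)
Lemma stat_kernel_small rho s : 0 < rho -> 0 < s ->
  \sum_a \sum_b stat_kernel 1 a b ^+ 2 = 2 * s ^+ 2 ->
  (forall al, 2 / rho <= (ns al)%:R) ->
  (forall al be ga, frob (link al be *m link be ga) <=
     rho / 4 * (frob (link al be) * frob (link be ga))) ->
  small_kernel (stat_kernel s) rho.
Proof.
move=> r0 s0 n2 nsr hG.
have nA : \sum_a \sum_b stat_kernel s a b ^+ 2 = 2.
  under eq_bigr do under eq_bigr do rewrite stat_kernel_scale exprMn.
  under eq_bigr do rewrite -mulr_sumr.
  by rewrite -mulr_sumr n2 exprVn mulrCA mulVf ?mulr1// expf_neq0// gt_eqF.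
split => //.
- exact: stat_kernel_sym.
- exact: stat_kernel_diag.
- move=> k.
  have h : influence (stat_kernel s) k * (ns (tag k))%:R <= 2.
    by rewrite -(card_samples ns (tag k)); exact: typed_kernel_infl.
  have V0 := influence_ge0 (stat_kernel s) k.
  rewrite -(ler_pM2r (_ : 0 < 2 / rho)) ?divr_gt0//.
  rewrite [X in _ <= X]mulrC divfK ?gt_eqF//.
  by apply: le_trans h; rewrite ler_wpM2l.
- have r4 : 0 <= rho / 4 by rewrite divr_ge0// ltW.
  have := typed_kernel_sqr (coef_sym s) link_sym nA r4 hG.
  by rewrite mulrC divfK// pnatr_eq0.
Qed.

End standardized_statistic.

(** * Convergence in distribution *)

Lemma near_Phi (R : realType) (x e : R) : 0 < e ->
  {for x, continuous (fun y : R => normal_prob (0 : R) 1 `]-oo, y]%classic)} ->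
  exists2 eta : R, 0 < eta &
    forall y, `|x - y| <= eta ->
    `|fine (normal_prob (0 : R) 1 `]-oo, x]%classic) -
      fine (normal_prob (0 : R) 1 `]-oo, y]%classic)| <= e.
Proof.
move=> e0 cx.
have fx : normal_prob (0 : R) 1 `]-oo, x]%classic =
    (fine (normal_prob (0 : R) 1 `]-oo, x]%classic))%:E.
  by rewrite fineK// fin_num_measure.
have : (fun y => normal_prob (0 : R) 1 `]-oo, y]%classic) y @[y --> x] -->
    (fine (normal_prob (0 : R) 1 `]-oo, x]%classic))%:E by rewrite -fx.
move=> /fine_cvgP[_ /cvgrPdist_le /(_ _ e0)] /nbhs_ballP[r /= r0 rx].
exists (r / 2); first by rewrite divr_gt0.
move=> y xy; apply: rx; rewrite /ball/=.
by apply: le_lt_trans xy _; rewrite ltr_pdivrMr// ltr_pMr// ltr1n.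
Qed.

(** A proportion converging to a positive limit forces the sample sizes to
    infinity. *)
Lemma samples_large (R : realType) (u : nat -> nat) (t M : R) : 0 < t ->
  (u n)%:R / n%:R @[n --> \oo] --> t -> \forall n \near \oo, M <= (u n)%:R.
Proof.
move=> t0 ut; have t20 : 0 < t / 2 by rewrite divr_gt0.
near=> n.
have n0 : 0 < n%:R :> R by rewrite ltr0n; near: n; exact: nbhs_infty_gt.
have h1 : t / 2 <= (u n)%:R / n%:R.
  have : `|t - (u n)%:R / n%:R| <= t / 2.
    by near: n; move/cvgrPdist_le : ut; exact.
  by rewrite ler_norml => /andP[_]; lra.
have h2 : M / (t / 2) <= n%:R by near: n; exact: nbhs_infty_ger.
move: h1 h2; rewrite ler_pdivlMr// ler_pdivrMr// mulrC => h1 h2.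
exact: le_trans h2 h1.
Unshelve. all: by end_near. Qed.

Theorem theorem2
  (R : realType)
  (K q : nat) (hK : (2 <= K)%N) (hq : (1 <= q < K)%N)
  (Gt : 'M[R]_(q, K)) (hGt : \rank Gt = q)
  (* sample sizes, as functions of the total sample size n *)
  (ns : nat -> 'I_K -> nat) (hns : forall n, (\sum_al ns n al)%N = n)
  (* population parameters and weights, as functions of the dimension p *)
  (m : nat -> nat)
  (mu : forall p, 'I_K -> 'cV[R]_p)
  (Gamma : forall p, 'I_K -> 'M[R]_(p, m p))
  (Sigma : forall p, 'I_K -> 'M[R]_p)
  (f : forall p, 'I_p -> R -> R)
  (a b : forall p, 'I_p -> R)
  (hf : forall p i, is_pdf (f p i))
  (ha : forall p i, pdf_mean (f p i) = (a p i)%:E)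
  (hb : forall p i, pdf_variance (f p i) = (b p i ^+ 2)%:E)
  (W : forall p, 'M[R]_p)
  (hW : forall p, W p = weight_mx (a p) (b p))
  (* the samples: one probability space for each pair (n, p) *)
  (disp : nat -> nat -> measure_display)
  (Omega : forall n p, measurableType (disp n p))
  (P : forall n p, probability (Omega n p) R)
  (Z : forall n p (al : 'I_K) (i : 'I_(ns n al)), {RV (P n p) >-> (m p).-tuple R})
  (Y : forall n p (al : 'I_K) (i : 'I_(ns n al)), Omega n p -> 'cV[R]_p)
  (* (A1) *)
  (hm : forall p, (p <= m p)%N)
  (hGamma : forall p al, Gamma p al *m (Gamma p al)^T = Sigma p al)
  (hY : forall n p al i w,
     Y n p al i w = Gamma p al *m (\col_s tnth (Z n p al i w) s) + mu p al)
  (hZindep : forall n p, mutually_independent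
     (fun k : {al : 'I_K & 'I_(ns n al)} => Z n p (tag k) (tagged k)))
  (hZid : forall n p, identically_distributed
     (fun k : {al : 'I_K & 'I_(ns n al)} => Z n p (tag k) (tagged k)))
  (hZstd : forall n p al i, centered_standardized (Z n p al i))
  (* (A2) *)
  (Delta : R)
  (hZ4 : forall n p al i s,
     'E_(P n p)[(fun w => tnth (Z n p al i w) s ^+ 4)%R]%E = (3 + Delta)%:E)
  (hZ8 : forall n p al i, mixed_moments_factor 8 (Z n p al i))
  (* (A3) *)
  (tau : 'I_K -> R) (htau : forall al, 0 < tau al < 1)
  (hns_tau : forall al, (ns n al)%:R / n%:R @[n --> \oo] --> tau al)
  (* (A4) *)
  (hA4 : forall al be ga,
     (fun p => \tr (W p *m Sigma p al *m W p *m Sigma p be *m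
                    W p *m Sigma p ga *m W p *m Sigma p be) : R^o)
     =o_\oo
     (fun p => \tr (W p *m Sigma p al *m W p *m Sigma p be) *
               \tr (W p *m Sigma p ga *m W p *m Sigma p be) : R^o))
  (T : forall n p, Omega n p -> R)
  (hT : forall n p w,
     T n p w = Tn0 Gt (W p) (fun al (i : 'I_(ns n al)) => Y n p al i w - mu p al))
  (* the normalization is meaningful *)
  (hVpos : \forall n \near \oo & p \near \oo, (0 < 'V_(P n p)[T n p])%E) :
  cvg_in_distribution (filter_prod \oo \oo)
    (fun np : nat * nat => P np.1 np.2)
    (fun np w => T np.1 np.2 w / Num.sqrt (fine 'V_(P np.1 np.2)[T np.1 np.2]))
    (normal_prob 0 1).
Proof.
have symW p : (W p)^T = W p by rewrite hW weight_mx_sym.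
pose L p al be := link (W p) (Gamma p) al be.
have sZ n p : sample_array (samples (Z n p)) Delta.
  split.
  - exact: hZindep.
  - by move=> k; exact: hZstd.
  - by move=> k; exact: hZ4.
  - by move=> k; exact: hZ8.
have TE n p s w : quad_stat (samples (Z n p))
    (stat_kernel Gt (ns := ns n) (W p) (Gamma p) s) w =
    T n p w / s.
  rewrite stat_Tn0 hT; congr (Tn0 _ _ _ / _).
  apply: functional_extensionality_dep => al; apply/funext => i.
  by rewrite hY addrK.
have T1 n p : T n p = quad_stat (samples (Z n p))
    (stat_kernel Gt (ns := ns n) (W p) (Gamma p) 1).
  by apply/funext => w; rewrite TE divr1.
move=> x cx.
have fin y : normal_prob (0 : R) 1 `]-oo, y]%classic =
    (fine (normal_prob (0 : R) 1 `]-oo, y]%classic))%:E.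
  by rewrite fineK// fin_num_measure.
rewrite [X in _ --> X]fin; apply/fine_cvgP; split.
  apply: nearW => -[n p]; apply: fin_num_measure => /=.
  have mT : measurable_fun setT (fun w => T n p w /
      Num.sqrt (fine 'V_(P n p)[T n p])).
    by apply: measurable_funM => //; rewrite T1; exact: quad_stat_meas.
  by rewrite -[X in measurable X]setTI; exact: mT.
apply/cvgrPdist_le => e e0.
have e20 : 0 < e / 2 by rewrite divr_gt0.
have [eta eta0 Hx] := near_Phi e20 cx.
have [rho r0 Hrho] := quad_stat_cdf Delta x eta0 e20.
have r40 : 0 < rho / 4 by rewrite divr_gt0.
have near_n : \forall n \near \oo, forall al, 2 / rho <= (ns n al)%:R.
  apply: filter_forall => al; apply: (samples_large _ _ (hns_tau al)).
  by case/andP: (htau al).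
have near_p : \forall p \near \oo, forall al be ga,
    frob (L p al be *m L p be ga) <= rho / 4 * (frob (L p al be) * frob (L p be ga)).
  apply: filter_forall => al; apply: filter_forall => be; apply: filter_forall => ga.
  move: (hA4 al be ga) => /eqoP /(_ _ r40); apply: filterS => p.
  have E2 al' be' : \tr (W p *m Sigma p al' *m W p *m Sigma p be') =
      frob (L p al' be') by rewrite -!hGamma -frob_bilinear.
  have E4 : \tr (W p *m Sigma p al *m W p *m Sigma p be *m W p *m Sigma p ga *m
      W p *m Sigma p be) = frob (L p al be *m L p be ga).
    by rewrite -!hGamma -frob_bilinear_mul.
  have frobC : frob (L p ga be) = frob (L p be ga).
    rewrite /L (link_sym _ (symW p) ga be) /frob exchange_big/=.
    by apply: eq_bigr => s _; apply: eq_bigr => t _; rewrite [X in _ = X ^+ 2]mxE.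
  rewrite E4 !E2 frobC ger0_norm ?frob_ge0// => /le_trans; apply.
  by rewrite ger0_norm// mulr_ge0 ?frob_ge0.
have hn : \forall np \near filter_prod \oo \oo, forall al, 2 / rho <= (ns np.1 al)%:R.
  exact: (cvg_fst near_n).
have hp : \forall np \near filter_prod \oo \oo, forall al be ga,
    frob (L np.2 al be *m L np.2 be ga) <=
    rho / 4 * (frob (L np.2 al be) * frob (L np.2 be ga)).
  exact: (cvg_snd near_p).
apply: filterS3 hVpos hn hp => -[n p] /= V0 nsr hG.
pose S := \sum_a \sum_b stat_kernel Gt (ns := ns n) (W p) (Gamma p) 1 a b ^+ 2.
have VE : 'V_(P n p)[T n p]%E = (2^-1 * S)%:E.
  by rewrite T1 (stat_variance _ _ (symW p) (sZ n p)).
rewrite VE/= in V0 *; set sd := Num.sqrt (2^-1 * S).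
have sd0 : 0 < sd by rewrite sqrtr_gt0 -lte_fin.
have S2 : S = 2 * sd ^+ 2.
  by rewrite sqr_sqrtr ?mulrA ?divff ?mul1r// ltW// -lte_fin.
have kA := stat_kernel_small (symW p) r0 sd0 S2 nsr hG.
have [] := Hrho _ _ _ _ _ _ _ (sZ n p) kA.
have -> : quad_stat (samples (Z n p)) (stat_kernel Gt (ns := ns n) (W p) (Gamma p) sd) =
    (fun w => T n p w / sd) by apply/funext => w; exact: TE.
have /Hx h1 : `|x - (x - eta)| <= eta by rewrite opprB addrC subrK gtr0_norm.
have /Hx h2 : `|x - (x + eta)| <= eta.
  by rewrite opprD addrA subrr add0r normrN gtr0_norm.
move: h1 h2; rewrite !ler_norml => /andP[h1 h1'] /andP[h2 h2'] lo up.
by apply/andP; split; lra.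
Qed.
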